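(* Let $S$ be the closed orientable surface of genus $2$, with fundamental class $[S]\in H_2(S;\mathbb{Z})=H_2(\pi_1(S);\mathbb{Z})$. For each integer $i$, there is a $C^\infty$ action $$\rho_i\colon \pi_1(S)\to \mathrm{Diffeo}^+(\mathbb{R}^2)$$ satisfying $$\rho_i^*([e])([S]) = i.$$ In particular, the Euler class $[e]\in H^2(\mathrm{Diffeo}^+(\mathbb{R}^2);\mathbb{Z})$ is unbounded.
   Context: $\mathrm{Homeo}^+(\mathbb{R}^2)$ is the group of orientation-preserving homeomorphisms of $\mathbb{R}^2$ and $\mathrm{Diffeo}^+(\mathbb{R}^2)$ is the subgroup of orientation-preserving $C^\infty$ diffeomorphisms. Cohomology is group cohomology of these groups regarded as abstract (discrete) groups. An action is a homomorphism, not assumed injective. The Euler class $[e]\in H^2(\mathrm{Homeo}^+(\mathbb{R}^2);\mathbb{Z})\cong\mathbb{Z}$ is a generator, characterized as follows. Let $\rho\colon G\to\mathrm{Homeo}^+(\mathbb{R}^2)$ be a homomorphism, let $G_\infty$ be the group of germs at $\infty$ of elements of $\rho(G)$, let $A$ be a punctured disk neighborhood of $\infty$ with universal cover $\widetilde{A}$, and let $\widehat{G}_\infty$ be the group of lifts to $\widetilde A$ of these germs. This gives a central extension $0\to\mathbb{Z}\to\widehat{G}_\infty\to G_\infty\to 0$, where $\mathbb{Z}$ is the deck group; the pullback of its class under $G\to G_\infty$ is $\rho^*([e])\in H^2(G;\mathbb{Z})$. Equivalently, $\rho^*([e])$ is the Euler class of the associated oriented flat $\mathbb{R}^2$-bundle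 over a $K(G,1)$. The Euler class on $\mathrm{Diffeo}^+(\mathbb{R}^2)$ is the restriction of $[e]$. A class in group cohomology $H^2(G)$ is bounded if it can be represented (with $\mathbb{R}$ coefficients) by a cocycle that is a bounded function on tuples of elements of $G$; otherwise it is unbounded. *)

(* Defs.v *)
From HB Require Import structures.
From mathcomp Require Import all_boot all_order all_algebra.
From mathcomp Require Import all_classical all_reals all_analysis.
From mathcomp.multinomials Require Import freeg.

Set Implicit Arguments.
Unset Strict Implicit.
Unset Printing Implicit Defensive.

Import Order.TTheory GRing.Theory Num.Theory.
Import numFieldNormedType.Exports.

Local Open Scope classical_set_scope.
Local Open Scope ring_scope.
Local Open Scope quotient_scope.

Section Smooth.
Variable R : realType.
Local Notation plane := (R * R)%type.

(* For maps on the plane, being Frechet differentiable with all directional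
   derivatives of class C^k is the same as being of class C^(k+1). *)
Fixpoint Ck (W : normedModType R) (k : nat) (f : plane -> W) : Prop :=
  if k is k'.+1 then
    (forall x, differentiable f x) /\ (forall v, Ck k' (fun x => 'D_v f x))
  else continuous f.

Definition smooth (W : normedModType R) (f : plane -> W) : Prop :=
  forall k, Ck k f.

Lemma Ck_continuous (W : normedModType R) k (f : plane -> W) :
  Ck k f -> continuous f.
Proof.
case: k => [//|k] [df _] x; exact/differentiable_continuous/df.
Qed.

Lemma CkW (W : normedModType R) k (f : plane -> W) : Ck k.+1 f -> Ck k f.
Proof.
elim: k f => [|k IH] f; first exact: Ck_continuous.
by move=> [df Df]; split => // v; apply: IH.
Qed.

Lemma Ck_ext (W : normedModType R) k (f g : plane -> W) :
  f =1 g -> Ck k f -> Ck k g.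
Proof. by move/funext => ->. Qed.

Lemma CkD (W : normedModType R) k (f g : plane -> W) :
  Ck k f -> Ck k g -> Ck k (fun x => f x + g x).
Proof.
elim: k f g => [|k IH] f g.
  by move=> cf cg x; apply: cvgD; [exact: cf|exact: cg].
move=> [df Df] [dg Dg]; split=> [x|v]; first exact: differentiableD.
apply: (@Ck_ext _ _ (fun x => 'D_v f x + 'D_v g x));
  last exact: IH (Df v) (Dg v).
by move=> x; rewrite (@deriveD _ _ _ f g) //; apply: diff_derivable.
Qed.

Lemma Ck_linear (W W' : normedModType R) (L : {linear W -> W'}) k
    (f : plane -> W) :
  continuous L -> Ck k f -> Ck k (L \o f).
Proof.
move=> cL; elim: k f => [|k IH] f.
  by move=> cf x; apply: continuous_comp; [exact: cf|exact: cL].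
move=> [df Df]; split=> [x|v].
  by apply: differentiable_comp => //; exact: linear_differentiable.
apply: (@Ck_ext _ _ (L \o (fun x => 'D_v f x))); last exact: IH (Df v).
have dL y : differentiable L y by exact: linear_differentiable.
move=> x /=; rewrite (deriveE v (df x)) deriveE;
  last exact: differentiable_comp.
by rewrite (diff_comp (df x) (dL _)) /= diff_lin.
Qed.

Lemma CkM k (f g : plane -> R) :
  Ck k f -> Ck k g -> Ck k (fun x => f x * g x).
Proof.
elim: k f g => [|k IH] f g.
  by move=> cf cg x; apply: cvgM; [exact: cf|exact: cg].
move=> Cf Cg; have [df Df] := Cf; have [dg Dg] := Cg.
split=> [x|v]; first exact: differentiableM.
apply: (@Ck_ext _ _ (fun x => f x * 'D_v g x + g x * 'D_v f x)).
  by move=> x; rewrite (@deriveM _ _ f g) //; apply: diff_derivable.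
by apply: CkD; apply: IH; by [exact: CkW | exact: Df | exact: Dg].
Qed.

Let e1 : plane := (1, 0).
Let e2 : plane := (0, 1).

Lemma Ck_fst k (g : plane -> plane) : Ck k g -> Ck k (fun x => (g x).1).
Proof.
by apply: (@Ck_linear _ _ (fst : {linear plane -> R})) => x; exact: cvg_fst.
Qed.

Lemma Ck_snd k (g : plane -> plane) : Ck k g -> Ck k (fun x => (g x).2).
Proof.
by apply: (@Ck_linear _ _ (snd : {linear plane -> R})) => x; exact: cvg_snd.
Qed.

Lemma plane_basis (p : plane) : p = p.1 *: e1 + p.2 *: e2.
Proof.
case: p => a b; apply/pair_equal_spec; split => /=.
  by rewrite -[RHS]/(a * 1 + b * 0) mulr1 mulr0 addr0.
by rewrite -[RHS]/(a * 0 + b * 1) mulr1 mulr0 add0r.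
Qed.

Lemma Ck_comp_scalar k (f : plane -> R) (g : plane -> plane) :
  Ck k f -> Ck k g -> Ck k (f \o g).
Proof.
elim: k f g => [|k IH] f g.
  by move=> cf cg x; apply: continuous_comp; [exact: cg|exact: cf].
move=> Cf Cg; have [df Df] := Cf; have [dg Dg] := Cg.
split=> [x|v]; first exact: differentiable_comp.
apply: (@Ck_ext _ _ (fun x => ('D_v g x).1 * ('D_e1 f \o g) x +
                              ('D_v g x).2 * ('D_e2 f \o g) x)).
  move=> x /=; rewrite [RHS]deriveE; last exact: differentiable_comp.
  rewrite diff_comp //= -(deriveE v (dg x)) !deriveE //.
  rewrite -[_ * _]/(_ *: _) -[X in _ + X]/(_ *: _) -!linearZ -linearD /=.
  by rewrite -plane_basis.
have Cg' := CkW Cg.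
apply: CkD; apply: CkM.
- exact: Ck_fst (Dg v).
- exact: IH (Df _) _.
- exact: Ck_snd (Dg v).
- exact: IH (Df _) _.
Qed.

Lemma Ck_pair k (f g : plane -> R) :
  Ck k f -> Ck k g -> Ck k (fun x => (f x, g x)).
Proof.
elim: k f g => [|k IH] f g.
  by move=> cf cg x; exact: (cvg_pair (cf x) (cg x)).
move=> [df Df] [dg Dg]; split=> [x|v]; first exact: differentiable_pair.
apply: (@Ck_ext _ _ (fun x => ('D_v f x, 'D_v g x)));
  last exact: IH (Df v) (Dg v).
move=> x; rewrite [RHS]deriveE; last exact: differentiable_pair.
by rewrite diff_pair //= !deriveE.
Qed.

Lemma smooth_comp (f g : plane -> plane) :
  smooth f -> smooth g -> smooth (f \o g).
Proof.
move=> sf sg k.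
apply: (@Ck_ext _ _ (fun x => ((f (g x)).1, (f (g x)).2))).
  by move=> x /=; case: (f (g x)).
apply: Ck_pair.
  exact: (@Ck_comp_scalar k (fun x => (f x).1) g (Ck_fst (sf k)) (sg k)).
exact: (@Ck_comp_scalar k (fun x => (f x).2) g (Ck_snd (sf k)) (sg k)).
Qed.

Lemma Ck_cst (W : normedModType R) k (w : W) : Ck k (fun=> w).
Proof.
elim: k w => [|k IH] w; first by move=> x; exact: cvg_cst.
split=> [x|v]; first exact: differentiable_cst.
by apply: (@Ck_ext _ _ (fun=> 0)) => // x; rewrite derive_cst.
Qed.

Lemma smooth_id : smooth (id : plane -> plane).
Proof.
case=> [|k]; first by move=> x; exact: cvg_id.
split=> [x|v]; first exact: ex_diff.
by apply: (@Ck_ext _ _ (fun=> v)) => [x|]; [rewrite derive_id|exact: Ck_cst].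
Qed.
End Smooth.

Section Cohomology.
Variables (G : groupType) (A : zmodType).

(* Inhomogeneous cochains with trivial coefficients. *)
Definition coboundary1 (b : G -> A) : G * G -> A :=
  fun '(g, h) => b h - b (g * h)%g + b g.

Definition coboundary2 (c : G * G -> A) : G * G * G -> A :=
  fun '(g, h, k) => c (h, k) - c ((g * h)%g, k) + c (g, (h * k)%g) - c (g, h).

Fact coboundary1_is_zmod_morphism : zmod_morphism coboundary1.
Proof.
move=> b b'; apply/funext => -[g h] /=.
rewrite -[RHS]/(_ (g, h) - _ (g, h)) /= -![(b - b') _]/(_ - _).
by rewrite !opprD !opprK !addrA [LHS](ACl (1*3*5*2*4*6)).
Qed.
HB.instance Definition _ :=
  GRing.isZmodMorphism.Build (G -> A) (G * G -> A)
    coboundary1 coboundary1_is_zmod_morphism.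

Fact coboundary2_is_zmod_morphism : zmod_morphism coboundary2.
Proof.
move=> c d; apply/funext => -[[g h] k] /=.
rewrite -[RHS]/(_ (g, h, k) - _ (g, h, k)) /= -![(c - d) _]/(_ - _).
by rewrite !opprD !opprK !addrA [LHS](ACl (1*3*5*7*2*4*6*8)).
Qed.
HB.instance Definition _ :=
  GRing.isZmodMorphism.Build (G * G -> A) (G * G * G -> A)
    coboundary2 coboundary2_is_zmod_morphism.

Definition is_cocycle : {pred G * G -> A} :=
  fun c => `[< coboundary2 c = 0 >].

Fact is_cocycle_closed : zmod_closed is_cocycle.
Proof.
split=> [|c d /asboolP dc /asboolP dd]; apply/asboolP; first exact: raddf0.
by rewrite raddfB /= dc dd subrr.
Qed.
HB.instance Definition _ :=
  GRing.isZmodClosed.Build (G * G -> A) is_cocycle is_cocycle_closed.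

Record cocycle := Cocycle {
  cocycle_fun :> G * G -> A;
  cocycleP : cocycle_fun \in is_cocycle }.
HB.instance Definition _ := [isSub for cocycle_fun].
HB.instance Definition _ := [Choice of cocycle by <:].
HB.instance Definition _ := [SubChoice_isSubZmodule of cocycle by <:].

Definition is_coboundary : {pred cocycle} :=
  fun c => `[< exists b, c = coboundary1 b :> (G * G -> A) >].

Fact is_coboundary_closed : zmod_closed is_coboundary.
Proof.
split=> [|c d /asboolP[b cE] /asboolP[b' dE]]; apply/asboolP.
  by exists 0; rewrite raddf0.
by exists (b - b'); rewrite raddfB /= -cE -dE.
Qed.
HB.instance Definition _ :=
  GRing.isZmodClosed.Build cocycle is_coboundary is_coboundary_closed.

Definition cohomology2 := Quotient.quot is_coboundary.
HB.instance Definition _ := GRing.Zmodule.on cohomology2.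
HB.instance Definition _ := Quotient.on cohomology2.

Definition cohom_class (c : cocycle) : cohomology2 := \pi c.

Lemma cohom_classP (c d : cocycle) :
  cohom_class c = cohom_class d <->
  exists b, c - d = coboundary1 b :> (G * G -> A).
Proof.
rewrite /cohom_class; split => [/eqmodP|cd].
  rewrite -[X in X -> _]/(is_true (Quotient.equiv _ _ _)) Quotient.equivE.
  by move=> /asboolP.
apply/eqmodP; rewrite -[X in is_true X]/(Quotient.equiv _ _ _) Quotient.equivE.
exact/asboolP.
Qed.

Lemma cohom_class_repr (x : cohomology2) : cohom_class (repr x) = x.
Proof. exact: reprK. Qed.
End Cohomology.

Fact cocycle_comp_subproof (G H : groupType) (A B : zmodType)
  (f : {multiplicative G -> H}) (phi : {additive A -> B}) (c : cocycle H A) :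
  (fun gh => phi (c (f gh.1, f gh.2))) \in @is_cocycle G B.
Proof.
apply/asboolP/funext => -[[g h] k] /=; rewrite !gmulfM -!(raddfB, raddfD).
have /asboolP/(congr1 (fun u => u (f g, f h, f k))) /= -> := cocycleP c.
by rewrite -[X in phi X]/(0 : A) raddf0.
Qed.

Definition cocycle_comp (G H : groupType) (A B : zmodType)
    (f : {multiplicative G -> H}) (phi : {additive A -> B}) (c : cocycle H A) :
    cocycle G B :=
  Cocycle (cocycle_comp_subproof f phi c).

(* Functoriality in the group (contravariant) and in the coefficients. *)
Definition cohomology2_map (G H : groupType) (A B : zmodType)
    (f : {multiplicative G -> H}) (phi : {additive A -> B})
    (x : cohomology2 H A) :
    cohomology2 G B :=
  cohom_class (cocycle_comp f phi (repr x)).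

Lemma cohomology2_mapE (G H : groupType) (A B : zmodType)
    (f : {multiplicative G -> H}) (phi : {additive A -> B}) (c : cocycle H A) :
  cohomology2_map f phi (cohom_class c) = cohom_class (cocycle_comp f phi c).
Proof.
apply/cohom_classP.
have /cohom_classP[b cE] := cohom_class_repr (cohom_class c).
exists (phi \o b \o f); apply/funext => -[g h] /=.
rewrite gmulfM -!(raddfB, raddfD).
have /= <- := congr1 (fun u => u (f g, f h)) cE.
by rewrite raddfB.
Qed.

Section FreeLift.
Variables (K : choiceType) (M : zmodType).

Definition zlift (f : K -> M) : {freeg K} -> M := fglift (f : K -> zmodule M).

Fact zlift_is_zmod_morphism f : zmod_morphism (zlift f).
Proof. by move=> x y; exact: (@lift_is_additive int K (zmodule M) f x y). Qed.
HB.instance Definition _ f :=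
  GRing.isZmodMorphism.Build {freeg K} M (zlift f) (zlift_is_zmod_morphism f).

Lemma zliftZ f (n : int) x : zlift f << n *g x >> = f x *~ n.
Proof. exact: (@liftU int (zmodule M) K f). Qed.

Lemma zliftU f x : zlift f << x >> = f x.
Proof. by rewrite zliftZ mulr1z. Qed.

Lemma zlift_uniq f (phi : {additive {freeg K} -> M}) :
  (forall x, phi << x >> = f x) -> phi =1 zlift f.
Proof.
move=> phiE; elim/freeg_ind_dom0 => [|n x D _ _ IH]; first by rewrite !raddf0.
rewrite !raddfD /= IH zliftZ -phiE -raddfMz; congr (phi _ + _).
by rewrite -[n in LHS]mul1r freeg_mulz mulrzz.
Qed.
End FreeLift.

Section Homology.
Variable G : groupType.

Definition boundary2 : {freeg (G * G)} -> {freeg G} :=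
  zlift (fun '(g, h) => << h >> - << (g * h)%g >> + << g >>).

Definition boundary3 : {freeg (G * G * G)} -> {freeg (G * G)} :=
  zlift (fun '(g, h, k) =>
    << (h, k) >> - << ((g * h)%g, k) >> + << (g, (h * k)%g) >> - << (g, h) >>).
HB.instance Definition _ := GRing.Additive.on boundary2.
HB.instance Definition _ := GRing.Additive.on boundary3.

Definition is_cycle : {pred {freeg (G * G)}} := fun z => boundary2 z == 0.

Fact is_cycle_closed : zmod_closed is_cycle.
Proof.
split=> [|z w /eqP dz /eqP dw]; apply/eqP; first exact: raddf0.
by rewrite raddfB /= dz dw subrr.
Qed.
HB.instance Definition _ :=
  GRing.isZmodClosed.Build {freeg (G * G)} is_cycle is_cycle_closed.

Record cycle2 := Cycle2 {
  cycle_chain :> {freeg (G * G)};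
  cycle2P : cycle_chain \in is_cycle }.
HB.instance Definition _ := [isSub for cycle_chain].
HB.instance Definition _ := [Choice of cycle2 by <:].
HB.instance Definition _ := [SubChoice_isSubZmodule of cycle2 by <:].

Definition is_boundary : {pred cycle2} :=
  fun z => `[< exists w, z = boundary3 w :> {freeg (G * G)} >].

Fact is_boundary_closed : zmod_closed is_boundary.
Proof.
split=> [|z z' /asboolP[w zE] /asboolP[w' zE']]; apply/asboolP.
  by exists 0; rewrite raddf0.
by exists (w - w'); rewrite raddfB /= -zE -zE'.
Qed.
HB.instance Definition _ :=
  GRing.isZmodClosed.Build cycle2 is_boundary is_boundary_closed.

Definition homology2 := Quotient.quot is_boundary.
HB.instance Definition _ := GRing.Zmodule.on homology2.
HB.instance Definition _ := Quotient.on homology2.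
Definition hom_class (z : cycle2) : homology2 := \pi z.

Lemma hom_classP (z w : cycle2) : hom_class z = hom_class w <->
  exists u, z - w = boundary3 u :> {freeg (G * G)}.
Proof.
rewrite /hom_class; split => [/eqmodP|zw].
  rewrite -[X in X -> _]/(is_true (Quotient.equiv _ _ _)) Quotient.equivE.
  by move=> /asboolP.
apply/eqmodP; rewrite -[X in is_true X]/(Quotient.equiv _ _ _) Quotient.equivE.
exact/asboolP.
Qed.

Lemma hom_class_repr (x : homology2) : hom_class (repr x) = x.
Proof. exact: reprK. Qed.

Variable A : zmodType.

Definition kronecker (x : cohomology2 G A) (y : homology2) : A :=
  zlift (repr x : cocycle G A) (repr y : cycle2).

Lemma zlift_coboundary1 (b : G -> A) z :
  zlift (coboundary1 b) z = zlift b (boundary2 z).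
Proof.
apply/esym; have := @zlift_uniq _ _ (coboundary1 b)
  (zlift b \o boundary2 : {additive {freeg (G * G)} -> A}); apply=> -[g h] /=.
by rewrite /boundary2 zliftU raddfD raddfB /= !zliftU.
Qed.

Lemma zlift_coboundary2 (c : G * G -> A) z :
  zlift (coboundary2 c) z = zlift c (boundary3 z).
Proof.
apply/esym; have := @zlift_uniq _ _ (coboundary2 c)
  (zlift c \o boundary3 : {additive {freeg (G * G * G)} -> A}).
apply=> -[[g h] k] /=.
by rewrite /boundary3 zliftU raddfB raddfD raddfB /= !zliftU.
Qed.

Lemma zliftB (f g : G * G -> A) z : zlift (f - g) z = zlift f z - zlift g z.
Proof.
apply/esym; have := @zlift_uniq _ _ (f - g)
  (zlift f \- zlift g : {additive {freeg (G * G)} -> A}); apply=> x /=.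
by rewrite !zliftU.
Qed.

Lemma zlift0 z : zlift (0 : G * G * G -> A) z = 0.
Proof.
by apply/esym; have := @zlift_uniq _ _ (0 : G * G * G -> A)
  (\0 : {additive {freeg (G * G * G)} -> A}); apply=> x /=.
Qed.

Lemma kroneckerE (c : cocycle G A) (z : cycle2) :
  kronecker (cohom_class c) (hom_class z) = zlift c z.
Proof.
rewrite /kronecker; set c' := repr _; set z' := repr _.
have /cohom_classP[b cE] : cohom_class c' = cohom_class c.
  exact: cohom_class_repr.
have /hom_classP[w zE] : hom_class z' = hom_class z by exact: hom_class_repr.
apply: (@etrans _ _ (zlift c z')); apply/eqP; rewrite -subr_eq0.
  have <- : zlift (coboundary1 b) z' = zlift c' z' - zlift c z'.
    by rewrite -zliftB -cE.
  by rewrite zlift_coboundary1 (eqP (cycle2P z')) raddf0.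
have <- : zlift c (boundary3 w) = zlift c z' - zlift c z by rewrite -raddfB -zE.
rewrite -zlift_coboundary2.
by have /asboolP -> := cocycleP c; rewrite zlift0.
Qed.
End Homology.

(* In a word, the letter (x, false) stands for the generator x and the letter
   (x, true) for its inverse. *)
Section PresentedGroup.
Variables (X : choiceType) (rels : set (seq (X * bool))).
Local Notation word := (seq (X * bool)).

Inductive word_eq : word -> word -> Prop :=
| word_eq_refl w : word_eq w w
| word_eq_sym w w' : word_eq w w' -> word_eq w' w
| word_eq_trans w w' w'' : word_eq w w' -> word_eq w' w'' -> word_eq w w''
| word_eq_cat u u' v v' :
    word_eq u u' -> word_eq v v' -> word_eq (u ++ v) (u' ++ v')
| word_eq_cancel x e : word_eq [:: (x, e); (x, ~~ e)] [::]
| word_eq_rel r : rels r -> word_eq r [::].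

Definition word_inv (w : word) : word := rev [seq (l.1, ~~ l.2) | l <- w].

Lemma word_inv_cat u v : word_inv (u ++ v) = word_inv v ++ word_inv u.
Proof. by rewrite /word_inv map_cat rev_cat. Qed.

Lemma word_mulV w : word_eq (w ++ word_inv w) [::].
Proof.
elim: w => [|[x e] w IH]; first exact: word_eq_refl.
rewrite -cat1s word_inv_cat -catA [w ++ _]catA.
apply: word_eq_trans (word_eq_cancel x e).
apply: (word_eq_cat (word_eq_refl [:: (x, e)])).
exact: (word_eq_cat IH (word_eq_refl [:: (x, ~~ e)])).
Qed.

Lemma word_invK : involutive word_inv.
Proof.
move=> w; rewrite /word_inv map_rev revK -map_comp -[RHS]map_id.
by apply: eq_map => -[x e] /=; rewrite negbK.
Qed.

Lemma word_Vmul w : word_eq (word_inv w ++ w) [::].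
Proof. by have := word_mulV (word_inv w); rewrite word_invK. Qed.

Lemma word_eq_inv w w' : word_eq w w' -> word_eq (word_inv w) (word_inv w').
Proof.
move=> ww'.
have Vw' : word_eq (word_inv w ++ w') [::].
  apply: word_eq_trans (word_Vmul w).
  by apply: word_eq_cat; [exact: word_eq_refl|exact: word_eq_sym].
apply: (@word_eq_trans _ (word_inv w ++ (w' ++ word_inv w'))).
  rewrite -[in X in word_eq X _](cats0 (word_inv w)).
  by apply: word_eq_cat; [exact: word_eq_refl|exact/word_eq_sym/word_mulV].
by rewrite catA; exact: word_eq_cat Vw' (word_eq_refl _).
Qed.

Definition word_eqb : rel word := fun w w' => `[< word_eq w w' >].

Fact word_eqb_equiv : equiv_class_of word_eqb.
Proof.
split=> [w|w w'|w' w w''].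
- exact/asboolP/word_eq_refl.
- by apply/asboolP/asboolP => /word_eq_sym.
- by move=> /asboolP ww' /asboolP w'w''; apply/asboolP/(word_eq_trans ww').
Qed.
Canonical word_eqb_equiv_rel := EquivRelPack word_eqb_equiv.

Definition presented_group := {eq_quot word_eqb}.
HB.instance Definition _ := Choice.on presented_group.
HB.instance Definition _ := EqQuotient.on presented_group.

Definition pres_class (w : word) : presented_group := \pi w.

Lemma pres_classP w w' : pres_class w = pres_class w' <-> word_eq w w'.
Proof.
split => [/eqmodP/asboolP //|ww'].
exact/eqmodP/asboolP.
Qed.

Lemma pres_class_repr x : pres_class (repr x) = x.
Proof. exact: reprK. Qed.

Definition pres_one : presented_group := pres_class [::].
Definition pres_mul (x y : presented_group) := pres_class (repr x ++ repr y).
Definition pres_inv (x : presented_group) := pres_class (word_inv (repr x)).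

Lemma pres_mulE w w' :
  pres_mul (pres_class w) (pres_class w') = pres_class (w ++ w').
Proof.
by apply/pres_classP/word_eq_cat; apply/pres_classP; exact: pres_class_repr.
Qed.

Lemma pres_invE w : pres_inv (pres_class w) = pres_class (word_inv w).
Proof.
by apply/pres_classP/word_eq_inv/pres_classP; exact: pres_class_repr.
Qed.

Fact pres_mulA : associative pres_mul.
Proof.
move=> x y z; rewrite -(pres_class_repr x) -(pres_class_repr y).
by rewrite -(pres_class_repr z) !pres_mulE catA.
Qed.

Fact pres_mul1 : left_id pres_one pres_mul.
Proof. by move=> x; rewrite -(pres_class_repr x) pres_mulE. Qed.

Fact pres_mulr1 : right_id pres_one pres_mul.
Proof. by move=> x; rewrite -(pres_class_repr x) pres_mulE cats0. Qed.

Fact pres_mulVx : left_inverse pres_one pres_inv pres_mul.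
Proof.
move=> x; rewrite -(pres_class_repr x) pres_invE pres_mulE.
exact/pres_classP/word_Vmul.
Qed.

Fact pres_mulxV : right_inverse pres_one pres_inv pres_mul.
Proof.
move=> x; rewrite -(pres_class_repr x) pres_invE pres_mulE.
exact/pres_classP/word_mulV.
Qed.

HB.instance Definition _ := isGroup.Build presented_group
  pres_mulA pres_mul1 pres_mulr1 pres_mulVx pres_mulxV.

Lemma pres_class_cat w w' :
  pres_class (w ++ w') = (pres_class w * pres_class w')%g.
Proof. by rewrite -pres_mulE. Qed.
End PresentedGroup.

Section SurfaceGroup.
Variable g : nat.

(* The standard presentation of the fundamental group of the closed orientable
   surface of genus g (for g >= 1): inl i is a_i, inr i is b_i, and the relator
   is the product of the a_i b_i a_i^-1 b_i^-1. *)
Definition surface_gen := ('I_g + 'I_g)%type.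

Definition surface_relator : seq (surface_gen * bool) :=
  flatten [seq [:: (inl i, false); (inr i, false); (inl i, true); (inr i, true)]
          | i <- enum 'I_g].

Definition surface_group : Type :=
  presented_group [set surface_relator].
HB.instance Definition _ := Group.on surface_group.

Definition surface_elt (x : surface_gen) : surface_group :=
  pres_class [set surface_relator] [:: (x, false)].

(* The surface is a 4g-gon with sides labelled by the relator and all vertices
   identified.  Coning the sides from the initial vertex cuts the polygon into
   triangles: with p the prefix of the relator read so far, a side x gives the
   simplex [p | x], a side x^-1 gives - [p x^-1 | x].  For g >= 1 the resulting
   cycle represents the image of the fundamental class in the homology of the
   group (Brown, Cohomology of Groups, II.5, exercise 4). *)
Fixpoint fan_chain (p : surface_group) (w : seq (surface_gen * bool)) :
    {freeg (surface_group * surface_group)} :=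
  match w with
  | [::] => 0
  | (x, false) :: w' =>
      let q := (p * surface_elt x)%g in
      << (p, surface_elt x) >> + fan_chain q w'
  | (x, true) :: w' =>
      let q := (p * (surface_elt x)^-1)%g in
      fan_chain q w' - << (q, surface_elt x) >>
  end.

Let signed_gen (l : surface_gen * bool) : {freeg surface_group} :=
  if l.2 then - << surface_elt l.1 >> else << surface_elt l.1 >>.

Lemma pres_class_letter x e :
  pres_class [set surface_relator] [:: (x, e)] =
  if e then (surface_elt x)^-1%g else surface_elt x.
Proof. by case: e => //; rewrite /surface_elt /= [RHS]pres_invE. Qed.

Lemma boundary_fan p w :
  boundary2 (fan_chain p w) =
  \sum_(l <- w) signed_gen l + << p >> - << (p * pres_class _ w)%g >>.
Proof.
elim: w p => [|[x e] w IH] p.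
  by rewrite /= raddf0 big_nil add0r mulg1 subrr.
rewrite big_cons -cat1s pres_class_cat pres_class_letter mulgA.
case: e => /=.
  rewrite raddfB /= IH {1}/boundary2 zliftU mulgVK /signed_gen /=.
  rewrite !opprD !opprK !addrA; set S := \sum_(_ <- _) _.
  by rewrite [LHS](ACl (4*1*5*3*(2*6)))/= subrr addr0.
rewrite raddfD /= IH {1}/boundary2 zliftU /signed_gen /=.
rewrite !addrA; set S := \sum_(_ <- _) _.
by rewrite [LHS](ACl (1*4*3*6*(2*5)))/= addNr addr0.
Qed.

Fact fundamental_cycle_subproof :
  fan_chain 1%g surface_relator \in @is_cycle surface_group.
Proof.
apply/eqP; rewrite boundary_fan mul1g.
have -> : pres_class [set surface_relator] surface_relator = 1%g.
  exact/pres_classP/word_eq_rel.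
rewrite addrK big_flatten /= big_map big1 // => i _.
by rewrite !big_cons big_nil /signed_gen /= addr0 -opprD addrA subrr.
Qed.

Definition fundamental_class : homology2 surface_group :=
  hom_class (Cycle2 fundamental_cycle_subproof).
End SurfaceGroup.

Section Plane.
Variable R : realType.
Local Notation plane := (R * R)%type.

(* The universal covering of the punctured plane: (s, t) |-> exp (s + i t).
   The neighborhoods of infinity lift to the half-planes s > T. *)
Definition polar (z : plane) : plane :=
  (expR z.1 * cos z.2, expR z.1 * sin z.2).

Definition deck (n : int) (z : plane) : plane := (z.1, z.2 + n%:~R * (2 * pi)).

(* The restriction of gamma to [0, 1] is a loop in the complement of x, with
   winding number n around x. *)
Definition winding (gamma : R -> plane) (x : plane) (n : int) : Prop :=
  exists F : R -> plane,
    [/\ {within `[0, 1], continuous F},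
        forall t, t \in `[0, 1] -> gamma t = x + polar (F t) &
        F 1 = deck n (F 0)].

(* Local degree 1 at every point, i.e. trivial action on the orientations
   H_1(R^2 - x; Z) of R^2, in terms of winding numbers. *)
Definition orientation_preserving (f : plane -> plane) : Prop :=
  forall gamma x n, winding gamma x n <-> winding (f \o gamma) (f x) n.

Record homeo_plus := HomeoPlus {
  homeo_fun :> plane -> plane;
  homeo_inv : plane -> plane;
  homeo_funK : cancel homeo_fun homeo_inv;
  homeo_invK : cancel homeo_inv homeo_fun;
  homeo_continuous : continuous homeo_fun;
  homeo_inv_continuous : continuous homeo_inv;
  homeo_orientation : orientation_preserving homeo_fun }.
HB.instance Definition _ := gen_eqMixin homeo_plus.
HB.instance Definition _ := gen_choiceMixin homeo_plus.

Lemma homeo_eq (f g : homeo_plus) : f =1 g -> f = g.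
Proof.
case: f g => [f f' fK f'K cf cf' of_] [g g' gK g'K cg cg' og] /= /funext fg.
move: gK g'K cg cg' og; rewrite -{}fg => gK g'K cg cg' og.
have f'g' : f' = g' by apply/funext => x; rewrite -{1}(g'K x) fK.
move: gK g'K cg cg' og; rewrite -{}f'g' => *.
by congr HomeoPlus; exact: Prop_irrelevance.
Qed.

Fact homeo_one_orientation : orientation_preserving id.
Proof. by []. Qed.

Definition homeo_one : homeo_plus :=
  @HomeoPlus id id (fun=> erefl) (fun=> erefl) (fun=> cvg_id) (fun=> cvg_id)
    homeo_one_orientation.

Fact homeo_mul_continuous (f g : plane -> plane) :
  continuous f -> continuous g -> continuous (f \o g).
Proof. by move=> cf cg x; apply: continuous_comp; [exact: cg|exact: cf]. Qed.

Fact homeo_mul_orientation (f g : plane -> plane) :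
  orientation_preserving f -> orientation_preserving g ->
  orientation_preserving (f \o g).
Proof. by move=> of_ og gamma x n; rewrite og of_. Qed.

Definition homeo_mul (f g : homeo_plus) : homeo_plus :=
  @HomeoPlus (f \o g) (homeo_inv g \o homeo_inv f)
    (can_comp (homeo_funK f) (homeo_funK g))
    (can_comp (homeo_invK g) (homeo_invK f))
    (homeo_mul_continuous (@homeo_continuous f) (@homeo_continuous g))
    (homeo_mul_continuous (@homeo_inv_continuous g) (@homeo_inv_continuous f))
    (homeo_mul_orientation (@homeo_orientation f) (@homeo_orientation g)).

Fact homeo_inv_orientation (f : homeo_plus) :
  orientation_preserving (homeo_inv f).
Proof.
move=> gamma x n; rewrite (homeo_orientation f (homeo_inv f \o gamma)).
rewrite homeo_invK.
by have -> : f \o (homeo_inv f \o gamma) = gamma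
  by apply/funext => t /=; rewrite homeo_invK.
Qed.

Definition homeo_invg (f : homeo_plus) : homeo_plus :=
  @HomeoPlus (homeo_inv f) f (homeo_invK f) (homeo_funK f)
    (@homeo_inv_continuous f) (@homeo_continuous f)
    (@homeo_inv_orientation f).

Fact homeo_mulA : associative homeo_mul.
Proof. by move=> f g h; exact: homeo_eq. Qed.
Fact homeo_mul1 : left_id homeo_one homeo_mul.
Proof. by move=> f; exact: homeo_eq. Qed.
Fact homeo_mulr1 : right_id homeo_one homeo_mul.
Proof. by move=> f; exact: homeo_eq. Qed.
Fact homeo_mulVx : left_inverse homeo_one homeo_invg homeo_mul.
Proof. by move=> f; apply: homeo_eq => x /=; rewrite homeo_funK. Qed.
Fact homeo_mulxV : right_inverse homeo_one homeo_invg homeo_mul.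
Proof. by move=> f; apply: homeo_eq => x /=; rewrite homeo_invK. Qed.

HB.instance Definition _ := isGroup.Build homeo_plus
  homeo_mulA homeo_mul1 homeo_mulr1 homeo_mulVx homeo_mulxV.

Definition is_diffeo : {pred homeo_plus} :=
  fun f => `[< smooth f /\ smooth (homeo_inv f) >].

Fact is_diffeo_closed : group_closed is_diffeo.
Proof.
split=> [|f g /asboolP[sf sf'] /asboolP[sg sg']]; apply/asboolP.
  by split; exact: smooth_id.
by split; exact: smooth_comp.
Qed.

Record diffeo_plus := DiffeoPlus {
  diffeo_homeo :> homeo_plus;
  diffeoP : diffeo_homeo \in is_diffeo }.
HB.instance Definition _ := [isSub for diffeo_homeo].
HB.instance Definition _ := [Choice of diffeo_plus by <:].
HB.instance Definition _ :=
  SubChoice_isSubGroup.Build homeo_plus is_diffeo diffeo_plus is_diffeo_closed.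

(* F represents a germ, at the end of the universal covering, lifting the germ
   of f at infinity. *)
Definition germ_lift (f F : plane -> plane) : Prop :=
  exists T : R, forall z : plane, T < z.1 ->
    {for z, continuous F} /\ polar (F z) = f (polar z).

Definition germ_eq (F F' : plane -> plane) : Prop :=
  exists T : R, forall z : plane, T < z.1 -> F z = F' z.

(* c is the cocycle, attached to a set-theoretic section s, of the pullback to
   Homeo^+(R^2) of the central extension by the deck group Z of the group of
   germs at infinity, i.e. the extension by the group of lifted germs:
   s(f) s(g) = deck (c(f, g)) s(fg). *)
Definition euler_cocycle (c : cocycle homeo_plus int) : Prop :=
  exists2 s : homeo_plus -> plane -> plane,
    forall f : homeo_plus, germ_lift f (s f) &
    forall f g : homeo_plus,
      germ_eq (s f \o s g) (deck (c (f, g)) \o s (f * g)%g).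

(* Every germ lifts to the simply connected half-planes s > T, two lifts differ
   by a unique deck transformation, and deck transformations commute with the
   lifts of orientation-preserving germs: Euler cocycles exist and form exactly
   one cohomology class, so the default value 0 is not used. *)
Definition euler_class : cohomology2 homeo_plus int :=
  xget 0 [set x | exists2 c, euler_cocycle c & x = cohom_class c].

Definition euler_class_diffeo : cohomology2 diffeo_plus int :=
  cohomology2_map (val : {multiplicative diffeo_plus -> homeo_plus})
    (idfun : {additive int -> int}) euler_class.

(* x is an integral class; the bounded cocycle has real coefficients. *)
Definition bounded_class (G : groupType) (x : cohomology2 G int) : Prop :=
  exists2 c : cocycle G R,
    cohom_class c = cohomology2_map (idfun : {multiplicative G -> G})
                      (intr : {additive int -> R}) x &
    exists M : R, forall g h, `|c (g, h)| <= M.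
End Plane.

(* Main.v *)
(* Let A be the dilation z |-> 2 z and B the rotation by the angle th(|z|^2),
   where th(u) = k ln u for u >= 1 and k ln 4 = 2 pi i.  Near infinity, in the
   coordinates (s, t) of the universal covering exp (s + i t), A and B lift to
   (s + ln 2, t) and (s, t + 2 k s), whose commutator is the deck transformation
   of index i.  So [B, A] is the identity near infinity; it is the rotation by
   an angle psi(|z|^2) with psi(u) = 0 for u >= 4, a compactly supported bump.
   Let T be the translation by (6, 0) and F the composition of the conjugates of
   this bump by the T^n, n >= 0, whose supports are disjoint.  Then
   F T = [B, A] T F, hence [B, A] [T, F] = 1, and the lifts of T and F at
   infinity commute because F is the identity far to the left.  The Euler number
   is the sum i + 0 of the indices of the two commutators of lifts.  With real
   coefficients, the Euler number is a sum of eight values of a cocycle, so that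
   a bounded cocycle has bounded Euler numbers. *)

From HB Require Import structures.
Require Import Defs.
From mathcomp Require Import all_boot all_order all_algebra.
From mathcomp Require Import all_classical all_reals all_analysis.
From mathcomp.multinomials Require Import freeg.
From mathcomp Require Import ring lra zify.

Set Implicit Arguments.
Unset Strict Implicit.
Unset Printing Implicit Defensive.

Import Order.TTheory GRing.Theory Num.Theory.
Import numFieldNormedType.Exports.

Local Open Scope classical_set_scope.
Local Open Scope ring_scope.

(** * Polar coordinates on the punctured plane and their deck transformations *)

Section Polar.
Variable R : realType.
Local Notation plane := (R * R)%type.

Definition dot (v w : plane) : R := v.1 * w.1 + v.2 * w.2.
Definition cross (v w : plane) : R := v.1 * w.2 - v.2 * w.1.
(** The oriented angle from [v] to [w] when [dot v w] is positive: the angle is then acute and the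
    arctangent of its tangent recovers it. *)
Definition ang (v w : plane) : R := atan (cross v w / dot v w).

Lemma dotC v w : dot v w = dot w v.
Proof. by rewrite /dot mulrC [v.2 * _]mulrC. Qed.

Lemma dotvv_ge0 v : 0 <= dot v v.
Proof. by rewrite /dot -!expr2 addr_ge0 ?sqr_ge0. Qed.

Lemma dotvv_eq0 v : (dot v v == 0) = (v == 0).
Proof.
case: v => a b; rewrite /dot /= -!expr2 paddr_eq0 ?sqr_ge0 // !sqrf_eq0.
by [].
Qed.

Lemma dotvv_gt0 v : v != 0 -> 0 < dot v v.
Proof. by move=> v0; rewrite lt_neqAle eq_sym dotvv_eq0 v0 dotvv_ge0. Qed.

Lemma dot_neq0 v w : 0 < dot v w -> v != 0 /\ w != 0.
Proof.
move=> d; split; apply: contraTneq d => ->; rewrite /dot /= ?mul0r ?mulr0.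
  by rewrite addr0 ltxx.
by rewrite addr0 ltxx.
Qed.

Lemma ang_id v : ang v v = 0.
Proof. by rewrite /ang /cross [v.2 * _]mulrC subrr mul0r atan0. Qed.

Lemma dot_polar (z : plane) : dot (polar z) (polar z) = expR (z.1 *+ 2).
Proof.
rewrite /dot /polar /= mulr2n expRD -[RHS]mulr1 -(cos2Dsin2 z.2); ring.
Qed.

Lemma polar_neq0 (z : plane) : polar z != 0.
Proof. by rewrite -dotvv_eq0 dot_polar expR_eq0. Qed.

(** An explicit local branch of the logarithm: as long as [w] makes an acute angle with [polar z],
    adding this angle to [z.2] gives an argument of [w]. The lifting arguments below rest on this
    formula. *)
Lemma polar_ang (z w : plane) : 0 < dot (polar z) w ->
  polar (ln (dot w w) / 2, z.2 + ang (polar z) w) = w.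
Proof.
move=> d0; have w0 := dotvv_gt0 (dot_neq0 d0).2.
rewrite /polar /ang.
set d := dot _ _ in d0 *; set x := cross _ _.
set r := expR _; have r0 : 0 < r by exact: expR_gt0.
have rr : r ^+ 2 = dot w w.
  by rewrite -expRM_natl /= mulrCA mulfV ?mulr1 ?lnK // pnatr_eq0.
set q := Num.sqrt (1 + (x / d) ^+ 2).
have q0 : 0 < q by rewrite sqrtr_gt0 ltr_pwDl ?sqr_ge0.
have qq : q ^+ 2 = 1 + (x / d) ^+ 2 by rewrite sqr_sqrtr // addr_ge0 ?sqr_ge0.
set phi := atan _.
have cE : cos phi = q^-1 by rewrite /phi cos_atan.
have sE : sin phi = x / d / q.
  rewrite -[x / d]atanK -/phi /tan cE invrK mulfK //; exact: lt0r_neq0.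
have e0 := expR_gt0 z.1.
(* Lagrange's identity: the squares of [dot] and [cross] add up to the product of the squared
   norms. *)
have dqE : d * q = expR z.1 * r.
  apply/eqP; rewrite -(eqrXn2 (n := 2)) ?mulr_ge0 ?ltW // !exprMn rr qq.
  have -> : d ^+ 2 * (1 + (x / d) ^+ 2) = d ^+ 2 + x ^+ 2.
    by rewrite mulrDr mulr1 -exprMn mulrCA mulfV ?mulr1 // lt0r_neq0.
  apply/eqP; rewrite /d /x /dot /cross /polar /=.
  transitivity (expR z.1 ^+ 2 * (cos z.2 ^+ 2 + sin z.2 ^+ 2) *
    (w.1 * w.1 + w.2 * w.2)); first by ring.
  by rewrite cos2Dsin2 mulr1.
have rE : r = d * q / expR z.1 by rewrite dqE mulrAC mulfV ?mul1r // lt0r_neq0.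
have [dN qN eN] : [/\ d != 0, q != 0 & expR z.1 != 0] by split; exact: lt0r_neq0.
rewrite [RHS]surjective_pairing /= cosD sinD cE sE rE; congr pair.
  transitivity ((cos z.2 * d - sin z.2 * x) / expR z.1).
    by field; rewrite dN qN eN.
  transitivity (w.1 * (cos z.2 ^+ 2 + sin z.2 ^+ 2)); last first.
    by rewrite cos2Dsin2 mulr1.
  by rewrite /d /x /dot /cross /polar /=; field.
transitivity ((sin z.2 * d + cos z.2 * x) / expR z.1).
  by field; rewrite dN qN eN.
transitivity (w.2 * (cos z.2 ^+ 2 + sin z.2 ^+ 2)); last first.
  by rewrite cos2Dsin2 mulr1.
by rewrite /d /x /dot /cross /polar /=; field.
Qed.

(** One of the four unit vectors on the axes makes an acute angle with [v], so that [polar_ang]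
    applies to it. *)
Lemma polar_surj (v : plane) : v != 0 -> exists z, polar z = v.
Proof.
move=> v0; suff [t dt] : exists t, 0 < dot (polar (0, t)) v.
  by exists (ln (dot v v) / 2, t + ang (polar (0, t)) v); exact: (polar_ang dt).
have dE t : dot (polar (0, t)) v = cos t * v.1 + sin t * v.2.
  by rewrite /dot /polar /= expR0 !mul1r.
under eq_exists do rewrite dE.
have [v1|v1|v1] := ltgtP v.1 0.
- by exists pi; rewrite cospi sinpi mul0r addr0 mulN1r oppr_gt0.
- by exists 0; rewrite cos0 sin0 mul0r addr0 mul1r.
rewrite v1; have [v2|v2|v2] := ltgtP v.2 0.
- exists (- (pi / 2)); rewrite mulr0 add0r sinN sin_pihalf.
  by rewrite mulN1r oppr_gt0.
- by exists (pi / 2); rewrite mulr0 add0r sin_pihalf mul1r.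
by case/eqP: v0; rewrite [v]surjective_pairing v1 v2.
Qed.

Lemma cosD2piz (t : R) (n : int) : cos (t + n%:~R * (2 * pi)) = cos t.
Proof.
have H (k : nat) t' : cos (t' + k%:R * (2 * pi)) = cos t' :> R.
  have -> : k%:R * (2 * pi) = pi *+ 2 *+ k :> R.
    by rewrite mulr_natl mulr_natl.
  exact: (periodicn (@cosD2pi R)).
case: n => k; first exact: H.
by rewrite NegzE mulrNz mulNr -[LHS](H k.+1) subrK.
Qed.

Lemma sinD2piz (t : R) (n : int) : sin (t + n%:~R * (2 * pi)) = sin t.
Proof.
have H (k : nat) t' : sin (t' + k%:R * (2 * pi)) = sin t' :> R.
  have -> : k%:R * (2 * pi) = pi *+ 2 *+ k :> R.
    by rewrite mulr_natl mulr_natl.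
  exact: (periodicn (@sinD2pi R)).
case: n => k; first exact: H.
by rewrite NegzE mulrNz mulNr -[LHS](H k.+1) subrK.
Qed.

Lemma polar_deck n (z : plane) : polar (deck n z) = polar z.
Proof. by rewrite /polar /deck /= cosD2piz sinD2piz. Qed.

Lemma deck_deck m n (z : plane) : deck m (deck n z) = deck (m + n) z.
Proof. by rewrite /deck /= intrD; congr pair; ring. Qed.

Lemma deck0 (z : plane) : deck 0 z = z.
Proof. by case: z => a b; rewrite /deck mul0r addr0. Qed.

Lemma twopi_gt0 : 0 < 2 * pi :> R.
Proof. by rewrite mulr_gt0 ?pi_gt0. Qed.

Lemma deck_inj (z : plane) : injective (fun n => deck n z).
Proof.
move=> m n [] /addrI /mulIf; rewrite gt_eqF ?twopi_gt0 // => /(_ isT).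
by move/intr_inj.
Qed.

(** After reduction to [0 <= u < 2 * pi], injectivity of the cosine on [[0, pi]] applies to [u] or
    to [2 * pi - u]. *)
Lemma cos_eq1_2pi (t : R) : cos t = 1 -> exists n : int, t = n%:~R * (2 * pi).
Proof.
move=> ct; set n := Num.floor (t / (2 * pi)); exists n.
have tp := twopi_gt0; have tpN := lt0r_neq0 tp.
pose u := t - n%:~R * (2 * pi).
have uE : t = u + n%:~R * (2 * pi) by rewrite subrK.
have u0 : 0 <= u.
  by rewrite subr_ge0 -ler_pdivlMr // floor_le.
have u2 : u < 2 * pi.
  rewrite ltrBlDr -[X in X + _]mul1r -mulrDl -ltr_pdivrMr // addrC.
  by rewrite -[1]/(1%:~R) -intrD floorD1_gt.
move: ct; rewrite uE cosD2piz => cu.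
suff -> : u = 0 by rewrite add0r.
have I0 : 0 \in `[0, pi : R] by rewrite in_itv /= lexx pi_ge0.
have [up|up] := leP u pi.
  by apply: (@cos_inj R); rewrite ?cu ?cos0 ?in_itv //= u0.
have : 2 * pi - u = 0.
  apply: (@cos_inj R) => //.
    by rewrite in_itv /=; lra.
  by rewrite cos0 cosB mulr_natl cos2pi sin2pi cu mul0r addr0 mulr1.
lra.
Qed.

Lemma polar_eq (z w : plane) : polar z = polar w -> exists n, z = deck n w.
Proof.
move=> zw; have : z.1 = w.1.
  have := dot_polar z; rewrite zw dot_polar => /expR_inj /eqP.
  by rewrite eqrMn2r /= => /eqP.
move: zw => [] /[swap] + + e; rewrite e.
have eN : expR w.1 != 0 by rewrite expR_eq0.
move=> /(mulfI eN) sE /(mulfI eN) cE.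
have : cos (z.2 - w.2) = 1 by rewrite cosB cE sE -!expr2 cos2Dsin2.
case/cos_eq1_2pi => n nE; exists n; case: z w nE e {sE cE eN} => a b [c d] /=.
by move=> nE ->; rewrite /deck /= -nE addrCA subrr addr0.
Qed.

End Polar.

(** * Continuity of the polar formulas *)

Section Continuity.
Variable R : realType.
Local Notation plane := (R * R)%type.

Section Limits.
Context {T : Type} {F : set_system T} {FF : Filter F}.

Lemma cvg_fst_of (f : T -> plane) (a : plane) : f x @[x --> F] --> a ->
  (f x).1 @[x --> F] --> a.1.
Proof. by move=> fa; apply: (continuous_cvg _ _ fa); exact: cvg_fst. Qed.

Lemma cvg_snd_of (f : T -> plane) (a : plane) : f x @[x --> F] --> a ->
  (f x).2 @[x --> F] --> a.2.
Proof. by move=> fa; apply: (continuous_cvg _ _ fa); exact: cvg_snd. Qed.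

Lemma cvg_dot (f g : T -> plane) (a b : plane) :
  f x @[x --> F] --> a -> g x @[x --> F] --> b ->
  dot (f x) (g x) @[x --> F] --> dot a b.
Proof.
by move=> fa gb; apply: cvgD; apply: cvgM;
  by [exact: cvg_fst_of | exact: cvg_snd_of].
Qed.

Lemma cvg_cross (f g : T -> plane) (a b : plane) :
  f x @[x --> F] --> a -> g x @[x --> F] --> b ->
  cross (f x) (g x) @[x --> F] --> cross a b.
Proof.
by move=> fa gb; apply: cvgB; apply: cvgM;
  by [exact: cvg_fst_of | exact: cvg_snd_of].
Qed.

Lemma cvg_ang (f g : T -> plane) (a b : plane) : 0 < dot a b ->
  f x @[x --> F] --> a -> g x @[x --> F] --> b ->
  ang (f x) (g x) @[x --> F] --> ang a b.
Proof.
move=> ab fa gb; apply: continuous_cvg; first exact: continuous_atan.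
apply: cvgM; first exact: cvg_cross.
by apply: cvgV; [exact: lt0r_neq0 | exact: cvg_dot].
Qed.

Lemma cvg_polar (f : T -> plane) (a : plane) : f x @[x --> F] --> a ->
  polar (f x) @[x --> F] --> polar a.
Proof.
move=> fa; have f1 := cvg_fst_of fa; have f2 := cvg_snd_of fa.
have fe : expR (f x).1 @[x --> F] --> expR a.1.
  by apply: (continuous_cvg _ _ f1); exact: continuous_expR.
have fc : cos (f x).2 @[x --> F] --> cos a.2.
  by apply: (continuous_cvg _ _ f2); exact: continuous_cos.
have fs : sin (f x).2 @[x --> F] --> sin a.2.
  by apply: (continuous_cvg _ _ f2); exact: continuous_sin.
exact: (cvg_pair (cvgM fe fc) (cvgM fe fs)).
Qed.

Lemma cvg_deck n (f : T -> plane) (a : plane) : f x @[x --> F] --> a ->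
  deck n (f x) @[x --> F] --> deck n a.
Proof.
move=> fa.
exact: (cvg_pair (cvg_fst_of fa) (cvgD (cvg_snd_of fa) (cvg_cst _))).
Qed.

(** The branch of the logarithm in [polar_ang] depends continuously on all its data. *)
Lemma cvg_log_polar (f g : T -> plane) (t : R) (h : T -> R) (a b : plane) :
  0 < dot a b -> h x @[x --> F] --> t ->
  f x @[x --> F] --> a -> g x @[x --> F] --> b ->
  ((ln (dot (g x) (g x)) / 2, h x + ang (f x) (g x)) : plane) @[x --> F] -->
  ((ln (dot b b) / 2, t + ang a b) : plane).
Proof.
move=> ab ht fa gb.
have gl : ln (dot (g x) (g x)) / 2 @[x --> F] --> ln (dot b b) / 2.
  apply: cvgM; last exact: cvg_cst.
  apply: (continuous_cvg _ _ (cvg_dot gb gb)).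
  by apply: continuous_ln; apply: dotvv_gt0; exact: (dot_neq0 ab).2.
exact: (cvg_pair gl (cvgD ht (cvg_ang ab fa gb))).
Qed.

End Limits.

Lemma near_dot_gt0 (X : topologicalType) (f g : X -> plane) x :
  0 < dot (f x) (g x) -> {for x, continuous f} -> {for x, continuous g} ->
  \forall y \near x, 0 < dot (f y) (g y).
Proof.
by move=> d cf cg; have := @cvgr_gt _ _ _ _ _ _ (cvg_dot cf cg) _ d; apply.
Qed.

End Continuity.

(** * Lifting paths to the universal covering *)

Section Lifting.
Variable R : realType.
Local Notation plane := (R * R)%type.

(** Connectedness of the line: the set where [P] holds is both open and closed. *)
Lemma locally_constant_prop (P : R -> Prop) :
  (forall r0, \forall r \near r0, P r <-> P r0) -> forall a b, P a -> P b.
Proof.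
move=> locP a b Pa.
have /(_ [set r | P r]) : connected [set: R].
  by apply/connected_intervalP => x y _ _ z _.
move=> H; suff E : [set r | P r] = setT by rewrite -[P b]/([set r | P r] b) E.
apply: H; first by exists a.
  exists [set r | P r]; last by rewrite setTI.
  by rewrite openE => r /= Pr; apply: filterS (locP r) => r' [_]; exact.
exists [set r | P r]; last by rewrite setTI.
rewrite -[[set r | P r]]setCK; apply: open_closedC.
by rewrite openE => r /= Pr; apply: filterS (locP r) => r' [H _] /H.
Qed.

Lemma int_valued_constant (g : R -> R) : continuous g ->
  (forall r, exists n : int, g r = n%:~R) -> forall a b, g a = g b.
Proof.
move=> cg ig a b.
apply: (@locally_constant_prop (fun r => g a = g r)) => // r0.
apply: filterS (@cvgr_dist_lt _ _ _ _ _ g _ (cg r0) 1 ltr01) => r.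
have [m ->] := ig r; have [n ->] := ig r0.
rewrite -intrB -intr_norm ltrz1 => mn; suff -> : m = n by [].
lia.
Qed.

(** The difference of the arguments, divided by 2 pi, is continuous and integer valued, hence
    constant. *)
Lemma lift_unique (F G : R -> plane) : continuous F -> continuous G ->
  (forall r, polar (F r) = polar (G r)) -> exists n, forall r, F r = deck n (G r).
Proof.
move=> cF cG FG; have p0 := lt0r_neq0 (twopi_gt0 R).
pose g r := ((F r).2 - (G r).2) / (2 * pi).
have gE r n : F r = deck n (G r) -> g r = n%:~R.
  by rewrite /g => -> /=; rewrite addrAC subrr add0r mulfK.
have [n nE] := polar_eq (FG 0); exists n => r.
have [m mE] := polar_eq (FG r); rewrite mE; congr deck.
apply: (@intr_inj R); rewrite -(gE _ _ nE) -(gE _ _ mE).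
apply: int_valued_constant => [x|x].
  apply: cvgM; last exact: cvg_cst.
  by apply: cvgB; apply: cvg_snd_of; [exact: cF|exact: cG].
by have [k kE] := polar_eq (FG x); exists k; exact: gE.
Qed.

(** The retraction of the line onto [[0, r]] if [r >= 0], and the constant 0 otherwise. Composing
    with it stops a path at time [r], and makes paths on [[0, 1]] continuous on the whole line. *)
Definition clamp (r x : R) := Num.max 0 (Num.min x r).

Lemma continuous_clamp r : continuous (clamp r).
Proof.
move=> x; apply: (@continuous_max _ _ (cst 0) (fun x => Num.min x r)).
  exact: cvg_cst.
by apply: (@continuous_min _ _ id (cst r)); [exact: cvg_id|exact: cvg_cst].
Qed.

Lemma clamp_id x : 0 <= x <= 1 -> clamp 1 x = x.
Proof. by move=> /andP[x0 x1]; rewrite /clamp min_l // max_r. Qed.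

Lemma clamp01 x : 0 <= clamp 1 x <= 1.
Proof. by rewrite /clamp le_max lexx ge_max ler01 ge_min lexx orbT. Qed.

(** The two values can differ only if [x] exceeds [r] or [r0], and then both are close to the
    stopping time. *)
Lemma clamp_near (e r r0 x : R) : `|r - r0| < e ->
  clamp r x = clamp r0 x \/
  `|clamp r x - Num.max 0 r0| < e /\ `|clamp r0 x - Num.max 0 r0| < e.
Proof.
rewrite ltr_distl => /andP[re er].
rewrite /clamp !ltr_distl.
case: (leP x r) => h1; case: (leP x r0) => h2; first (by left); right.
all: case: (leP 0 x) => h3; case: (leP 0 r) => h4; case: (leP 0 r0) => h5.
all: by split; lra.
Qed.

(** [P r] says that the path stopped at time [r] lifts. Its truth is locally constant in [r], and it
    holds at 0, where the stopped path is constant. *)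
Lemma path_lift (h : R -> plane) : continuous h -> (forall r, h r != 0) ->
  exists2 F : R -> plane, continuous F & forall r, polar (F r) = h (clamp 1 r).
Proof.
move=> ch h0; pose P r := exists2 F : R -> plane, continuous F &
  forall x, polar (F x) = h (clamp r x).
have chc r : continuous (h \o clamp r).
  by move=> x; apply: continuous_comp; [exact: continuous_clamp|exact: ch].
(* A lift of one stopped path, turned by the acute angles between the two paths, becomes a lift of
   the other. *)
have step r r' : (forall x, 0 < dot (h (clamp r x)) (h (clamp r' x))) ->
    P r -> P r'.
  move=> d [F cF FE].
  exists (fun x => (ln (dot (h (clamp r' x)) (h (clamp r' x))) / 2,
              (F x).2 + ang (h (clamp r x)) (h (clamp r' x)))).
    move=> x; apply: cvg_log_polar; [exact: d| |exact: chc|exact: chc].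
    by apply: cvg_snd_of; exact: cF.
  by move=> x; rewrite -FE polar_ang // FE.
apply: (@locally_constant_prop P _ 0).
  move=> r0; set c := Num.max 0 r0.
  (* Paths stopped at times near [r0] differ only close to the end point [h c], where by continuity
     the angles are acute. *)
  have : \forall p \near ((c, c) : R * R), 0 < dot (h p.1) (h p.2).
    apply: near_dot_gt0; first exact: dotvv_gt0.
      by apply: continuous_comp; [exact: cvg_fst|exact: ch].
    by apply: continuous_comp; [exact: cvg_snd|exact: ch].
  case/nbhs_ballP => e /= e0 He.
  apply: filterS (@cvgr_dist_lt _ _ _ (nbhs r0) _ id r0 cvg_id e e0) => r /=.
  rewrite distrC => re.
  have d x : 0 < dot (h (clamp r x)) (h (clamp r0 x)).
    have [->|[H1 H2]] := clamp_near x re; first exact: dotvv_gt0.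
    by apply: (He (_, _)); split; rewrite /ball /= distrC.
  by split; apply: step => // x; rewrite dotC.
have [z zE] := polar_surj (h0 0); exists (cst z); first by move=> x; exact: cvg_cst.
by move=> x; rewrite zE /clamp max_l // ge_min lexx orbT.
Qed.

End Lifting.

(** * Lifting maps of the plane, and winding numbers *)

Section PlaneLifting.
Variable R : realType.
Local Notation plane := (R * R)%type.

(** Compactness of [[0, 1]] makes the neighborhood of [z0] uniform in [r]. *)
Lemma near_ray_dot_gt0 (H : plane -> plane) (z0 : plane) :
  continuous H -> (forall z, H z != 0) ->
  \forall z \near z0, forall r : R, 0 <= r <= 1 ->
    0 < dot (H (r *: z0)) (H (r *: z)).
Proof.
move=> cH H0.
have /compact_near_coveringP K := @segment_compact R 0 1.
have := K plane (nbhs z0) (fun z r => 0 < dot (H (r *: z0)) (H (r *: z))) _.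
move=> /(_ _) L; apply: filterS (L _) => [z + r r01|r _].
  by apply; rewrite /= in_itv.
have /= := @near_dot_gt0 R (R * plane)%type (fun p => H (p.1 *: z0))
  (fun p => H (p.1 *: p.2)) (r, z0) (dotvv_gt0 (H0 _)).
apply.
  apply: continuous_comp; last exact: cH.
  by apply: (@cvgZ _ _ _ _ _ fst (cst z0)); [exact: cvg_fst|exact: cvg_cst].
apply: continuous_comp; last exact: cH.
by apply: (@cvgZ _ _ _ _ _ fst snd); [exact: cvg_fst|exact: cvg_snd].
Qed.

(** [H] is lifted along each ray from the origin, always starting at [p0], and the value at time 1
    defines the lift. It is continuous because near [z0] it coincides with the continuous formula
    [F']. *)
Lemma plane_lift (H : plane -> plane) : continuous H -> (forall z, H z != 0) ->
  exists2 F : plane -> plane, continuous F & forall z, polar (F z) = H z.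
Proof.
move=> cH H0; have [p0 p0E] := polar_surj (H0 0).
have lifts z : exists G : R -> plane, [/\ continuous G,
    forall r, polar (G r) = H (clamp 1 r *: z) & G 0 = p0].
  have [||G cG GE] := @path_lift R (fun r => H (r *: z)).
  - move=> r; apply: continuous_comp; last exact: cH.
    by apply: (@cvgZ _ _ _ _ _ id (cst z)); [exact: cvg_id|exact: cvg_cst].
  - by move=> r.
  have [n nE] : exists n, p0 = deck n (G 0).
    by apply: polar_eq; rewrite GE p0E clamp_id ?lexx ?ler01 // scale0r.
  exists (deck n \o G); split=> // r.
    by apply: cvg_deck; exact: cG.
  by rewrite /= polar_deck.
have [G GP] := choice lifts.
have FE z : polar (G z 1) = H z.
  by have [_ -> _] := GP z; rewrite clamp_id ?lexx ?ler01 // scale1r.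
exists (fun z => G z 1) => // z0.
have [cG0 G0E G00] := GP z0.
pose F' z := (ln (dot (H z) (H z)) / 2, (G z0 1).2 + ang (H z0) (H z)).
have cF' : F' z @[z --> z0] --> F' z0.
  apply: cvg_log_polar; [exact: dotvv_gt0|exact: cvg_cst|exact: cvg_cst|].
  exact: cH.
have F'E : \forall z \near z0, F' z = G z 1.
  apply: filterS (@near_ray_dot_gt0 H z0 cH H0) => z d.
  have [cG GE G0] := GP z.
  (* The lift along the ray to [z0], turned at each time by the acute angle towards the ray to [z],
     is a second lift along the ray to [z]. *)
  pose K r := (ln (dot (H (clamp 1 r *: z)) (H (clamp 1 r *: z))) / 2,
     (G z0 r).2 + ang (H (clamp 1 r *: z0)) (H (clamp 1 r *: z))).
  have cHc w : continuous (fun r => H (clamp 1 r *: w)).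
    move=> r; apply: continuous_comp; last exact: cH.
    apply: (@cvgZ _ _ _ _ _ (clamp 1) (cst w)); last exact: cvg_cst.
    exact: continuous_clamp.
  have cK : continuous K.
    move=> r; apply: cvg_log_polar; [exact/d/clamp01| |exact: cHc|exact: cHc].
    by apply: cvg_snd_of; exact: cG0.
  have KE r : polar (K r) = polar (G z r).
    by rewrite GE /K -G0E polar_ang // G0E; exact/d/clamp01.
  have [n nE] := lift_unique cK cG KE.
  (* Both lifts start at [p0], so the deck transformation between them is trivial. *)
  have n0 : n = 0.
    apply: (@deck_inj R p0); rewrite deck0 -{1}G0 -nE /K.
    rewrite clamp_id ?lexx ?ler01 // !scale0r ang_id addr0 G00 -p0E dot_polar.
    by rewrite expRK -[_ *+ 2]mulr_natr mulfK ?pnatr_eq0 // -surjective_pairing.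
  have := nE 1; rewrite n0 deck0 => <-.
  by rewrite /K /F' clamp_id ?lexx ?ler01 // !scale1r.
rewrite /continuous_at -(nbhs_singleton F'E).
by apply: cvg_trans cF'; apply: near_eq_cvg; exact: F'E.
Qed.

(** Composition with [clamp 1] replaces continuity within [[0, 1]] by continuity on the line. *)
Lemma winding_path (gamma : R -> plane) x n : winding gamma x n ->
  exists F : R -> plane, [/\ continuous F,
    forall t, gamma (clamp 1 t) = x + polar (F t) & F 1 = deck n (F 0)].
Proof.
case=> F [cF gE F1]; exists (F \o clamp 1); split=> [t|t|].
- have c01 : `[0%R, 1%R]%classic (clamp 1 t) by rewrite /= in_itv /= clamp01.
  have /subspace_continuousP/(_ _ c01) cFt := cF.
  move=> W /cFt WF; have := @continuous_clamp R 1 t _ WF.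
  rewrite !nbhs_simpl; apply: (@filterS _ (nbhs t)) => u /=; apply.
  by rewrite /= in_itv /= clamp01.
- by apply: gE; rewrite in_itv /= clamp01.
- by rewrite /= !clamp_id ?lexx ?ler01.
Qed.

Lemma path_winding (gamma F : R -> plane) x n : continuous F ->
  (forall t, 0 <= t <= 1 -> gamma t = x + polar (F t)) -> F 1 = deck n (F 0) ->
  winding gamma x n.
Proof.
move=> cF gE F1; exists F; split; [exact: continuous_subspaceT| |by []].
by move=> t; rewrite in_itv /=; exact: gE.
Qed.

Lemma winding_unique (gamma : R -> plane) x m n :
  winding gamma x m -> winding gamma x n -> m = n.
Proof.
move=> /winding_path[F [cF FE F1]] /winding_path[G [cG GE G1]].
have FG t : polar (F t) = polar (G t) by apply: (addrI x); rewrite -FE GE.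
have [k kE] := lift_unique cF cG FG.
have := F1; rewrite !kE G1 deck_deck deck_deck addrC => /deck_inj.
by move/addIr.
Qed.

(* Rouche's theorem for winding numbers: gamma and delta, seen from x and y, are
   never in opposite directions. *)
Lemma winding_dot (gamma delta : R -> plane) x y n :
  continuous (delta \o clamp 1) -> delta 0 = delta 1 ->
  (forall t, 0 <= t <= 1 -> 0 < dot (gamma t - x) (delta t - y)) ->
  winding gamma x n -> winding delta y n.
Proof.
move=> cd d01 d /winding_path[F [cF FE F1]].
have PE t : polar (F t) = gamma (clamp 1 t) - x by rewrite FE addrAC subrr add0r.
pose D t := delta (clamp 1 t) - y.
have cD : continuous D by move=> t; apply: cvgB; [exact: cd|exact: cvg_cst].
have d' t : 0 < dot (polar (F t)) (D t) by rewrite PE; exact/d/clamp01.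
pose G t := (ln (dot (D t) (D t)) / 2, (F t).2 + ang (polar (F t)) (D t)).
apply: (@path_winding delta G).
- move=> t; apply: cvg_log_polar; [exact: d'| | |exact: cD].
    by apply: cvg_snd_of; exact: cF.
  by apply: cvg_polar; exact: cF.
- by move=> t t01; rewrite polar_ang // /D clamp_id // addrC subrK.
- have DE : D 1 = D 0 by rewrite /D !clamp_id ?lexx ?ler01 // d01.
  by rewrite /G DE F1 polar_deck /deck /=; congr pair; ring.
Qed.

(** By injectivity, the vector from [Phi s x] to [Phi s (g t)] never vanishes, so it lifts as a
    function of [(s, t)] on the plane. The index between the sides [t = 1] and [t = 0] is the same
    for all [s], and is [n] for [s = 0]. *)
Lemma isotopy_winding (Phi : R -> plane -> plane) :
  continuous (fun p : R * plane => Phi p.1 p.2) ->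
  (forall s, injective (Phi s)) -> (forall z, Phi 0 z = z) ->
  forall gamma x n, winding gamma x n ->
    winding (Phi 1 \o gamma) (Phi 1 x) n.
Proof.
move=> cPhi iPhi Phi0 gamma x n /winding_path[F [cF FE F1]].
pose g t := x + polar (F t).
have cg : continuous g.
  by move=> t; apply: cvgD; [exact: cvg_cst|apply: cvg_polar; exact: cF].
pose H (p : plane) := Phi p.1 (g p.2) - Phi p.1 x.
have cH : continuous H.
  have cf : continuous (fst : plane -> R) by move=> p; exact: cvg_fst.
  have cs : continuous (g \o snd : plane -> plane).
    by move=> p; apply: continuous_comp; [exact: cvg_snd|exact: cg].
  move=> p; apply: cvgB.
    by apply: (@continuous_comp _ _ _ (fun p => (p.1, g p.2)) (fun p : R * plane => Phi p.1 p.2));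
      [exact: (cvg_pair (cf p) (cs p))|exact: cPhi].
  by apply: (@continuous_comp _ _ _ (fun p => (p.1, x)) (fun p : R * plane => Phi p.1 p.2));
    [exact: (cvg_pair (cf p) (cvg_cst _))|exact: cPhi].
have H0 p : H p != 0.
  rewrite subr_eq0; apply/negP => /eqP /iPhi /eqP.
  by rewrite -subr_eq0 /g addrAC subrr add0r (negbTE (polar_neq0 _)).
have [L cL LE] := plane_lift cH H0.
have cLat a : continuous (fun s => L (s, a)).
  move=> s; apply: (@continuous_comp _ _ _ (fun s => (s, a)) L); last exact: cL.
  exact: (cvg_pair cvg_id (cvg_cst _)).
have cLst s : continuous (fun t => L (s, t)).
  move=> t; apply: (@continuous_comp _ _ _ (fun t => (s, t)) L); last exact: cL.
  exact: (cvg_pair (cvg_cst _) cvg_id).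
(* The sides [t = 1] and [t = 0] lift the same path in [s], since the loop closes up; [m] is the
   index between them. *)
have [s|m mE] := lift_unique (cLat 1) (cLat 0).
  by rewrite !LE /H /= /g F1 polar_deck.
(* For [s = 0] the lift is [F] up to a deck transformation, which identifies [m] with [n]. *)
have [t|q qE] := lift_unique (cLst 0) cF.
  by rewrite !LE /H /= !Phi0 /g addrAC subrr add0r.
have mn : m = n.
  have := mE 0; rewrite !qE F1 !deck_deck addrC => /deck_inj /esym.
  by move/addIr.
apply: (@path_winding _ (fun t => L (1, t))); first exact: cLst.
  move=> t t01; rewrite LE /H /= addrC subrK /g -FE clamp_id //.
by rewrite mE mn.
Qed.

(** [orientation_preserving] asks for an equivalence; its converse half for [f] follows from the
    direct half for the inverse map. *)
Lemma orientation_of_winding (f g : plane -> plane) :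
  cancel f g ->
  (forall gamma x n, winding gamma x n -> winding (f \o gamma) (f x) n) ->
  (forall gamma x n, winding gamma x n -> winding (g \o gamma) (g x) n) ->
  orientation_preserving f.
Proof.
move=> fK wf wg gamma x n; split; first exact: wf.
move/wg; rewrite fK.
by have -> : g \o (f \o gamma) = gamma by apply/funext => t /=; rewrite fK.
Qed.

End PlaneLifting.

(** * Germs at infinity, their lifts, and the Euler cocycle *)

Section Germs.
Variable R : realType.
Local Notation plane := (R * R)%type.
Implicit Types (f g h : homeo_plus R) (F G : plane -> plane).

Definition near_end (P : plane -> Prop) := exists T : R, forall z, T < z.1 -> P z.

Lemma near_end_and (P Q : plane -> Prop) :
  near_end P -> near_end Q -> near_end (fun z => P z /\ Q z).
Proof.
move=> [T PT] [U QU]; exists (Num.max T U) => z; rewrite gt_max => /andP[Tz Uz].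
by split; [exact: PT|exact: QU].
Qed.

Lemma near_endW (P Q : plane -> Prop) :
  (forall z, P z -> Q z) -> near_end P -> near_end Q.
Proof. by move=> PQ [T PT]; exists T => z /PT /PQ. Qed.

Lemma near_end_ex (P : plane -> Prop) : near_end P -> exists z, P z.
Proof. by case=> T PT; exists (T + 1, 0); apply: PT; rewrite /= ltrDl. Qed.

(** The inverse of [f] is bounded on a compact square containing all points of squared norm at most
    [M], so [f] sends every point beyond that bound outside the square. *)
Lemma homeo_proper f (M : R) :
  near_end (fun z => M < dot (f (polar z)) (f (polar z))).
Proof.
pose r : R := 1 + `|M|.
pose B : set plane := `[- r, r] `*` `[- r, r].
have r0 : 0 < r by rewrite /r ltr_pwDl.
have B0 : B !=set0.
  by exists (0, 0); split; rewrite /= in_itv /= oppr_le0 ltW.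
have cB : compact B by apply: compact_setX; exact: segment_compact.
pose N v := dot (homeo_inv f v) (homeo_inv f v).
have cN : {within B, continuous N}.
  apply: continuous_subspaceT => v.
  by apply: cvg_dot; exact: homeo_inv_continuous.
have [c _ cmax] := compact_EVT_max B0 cB cN.
(* The squared norm of [polar z] is at least [1 + 2 * z.1], which exceeds [N c] as soon as [z.1]
   does. *)
exists (N c) => z Nz; rewrite ltNge; apply/negP => fM.
have : N (f (polar z)) <= N c.
  apply: cmax; rewrite inE; move: fM; set v := f _ => vM.
  have bnd a b : a * a + b * b <= M -> - r <= a <= r.
    have := ler_norm M; rewrite /r; set m := `|M| => mM abM.
    have m0 : 0 <= m by exact: normr_ge0.
    by have b2 := sqr_ge0 b; rewrite expr2 in b2; apply/andP; split; nra.
  split; rewrite /= in_itv /=; first exact: (bnd _ v.2).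
  by apply: (bnd _ v.1); rewrite addrC.
rewrite {1}/N homeo_funK dot_polar leNgt => /negP; apply.
apply: lt_le_trans (expR_ge1Dx _); apply: (lt_trans Nz).
have Nc0 : 0 <= N c by exact: dotvv_ge0.
by move: (N c) Nc0 Nz => Nc Nc0 Nz; rewrite mulr2n; lra.
Qed.

(** By properness, [F] maps a far half-plane into any given one; this is what allows lifted germs to
    be composed. *)
Lemma germ_lift_end f F (P : plane -> Prop) :
  germ_lift f F -> near_end P -> near_end (fun z => P (F z)).
Proof.
move=> [T FT] [U PU].
have [V fV] := homeo_proper f (expR (U *+ 2)).
exists (Num.max T V) => z; rewrite gt_max => /andP[/FT[_ FE] /fV].
by rewrite -FE dot_polar ltr_expR ltrMn2r /= => /PU.
Qed.

(** Freezing the first coordinate at [T + 1] to the left of that line extends the map from a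
    half-plane, where it does not vanish, to the whole plane, where [plane_lift] applies. *)
Lemma germ_lift_exists f : exists F, germ_lift f F.
Proof.
have [T fT] := homeo_proper f 0.
pose c (z : plane) : plane := (Num.max (T + 1) z.1, z.2).
have cc : continuous c.
  move=> z; have c1 : Num.max (T + 1) w.1 @[w --> z] --> Num.max (T + 1) z.1.
    apply: (@continuous_max _ _ (cst (T + 1)) fst); first exact: cvg_cst.
    exact: cvg_fst.
  exact: (cvg_pair c1 cvg_snd).
have [||F cF FE] := @plane_lift R (fun z => f (polar (c z))).
- have cpc : continuous (@polar R \o c) by move=> z; apply: cvg_polar; exact: cc.
  exact: (homeo_mul_continuous (@homeo_continuous R f) cpc).
- by move=> z; rewrite -dotvv_eq0 gt_eqF // fT // lt_max ltrDl ltr01.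
exists F, (T + 1) => z Tz; split; first exact: cF.
by rewrite FE /c max_r ?ltW // -surjective_pairing.
Qed.

(** A half-plane is convex: uniqueness of path lifts along the segment from [z0] to [z] carries the
    index at [z0] over to [z]. *)
Lemma half_plane_lift_unique T F G :
  (forall z : plane, T < z.1 -> [/\ {for z, continuous F},
     {for z, continuous G} & polar (F z) = polar (G z)]) ->
  exists n, forall z, T < z.1 -> F z = deck n (G z).
Proof.
move=> FG; pose z0 : plane := (T + 1, 0).
have Tz0 : T < z0.1 by rewrite ltrDl.
have [_ _ /polar_eq[n nE]] := FG _ Tz0.
exists n => z Tz.
pose p (t : R) : plane := z0 + clamp 1 t *: (z - z0).
have cp : continuous p.
  move=> t; apply: cvgD; first exact: cvg_cst.
  apply: (@cvgZ _ _ _ _ _ (clamp 1) (cst (z - z0))); last exact: cvg_cst.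
  exact: continuous_clamp.
have Tp t : T < (p t).1.
  have -> : (p t).1 = z0.1 + clamp 1 t * (z.1 - z0.1) by [].
  have := clamp01 t; set u := clamp 1 t => /andP[u0 u1].
  have [u1'|u1'] := eqVneq u 1; first by rewrite u1' mul1r addrC subrK.
  have u2 : u < 1 by rewrite lt_neqAle u1'.
  have -> : z0.1 + u * (z.1 - z0.1) = T + ((1 - u) * (z0.1 - T) + u * (z.1 - T)).
    by ring.
  rewrite ltrDl ltr_wpDr ?mulr_ge0 ?mulr_gt0 ?subr_gt0 ?subr_ge0 //; exact: ltW.
have cK (K : plane -> plane) : (forall t, {for p t, continuous K}) ->
    continuous (K \o p).
  by move=> cK t; apply: continuous_comp; [exact: cp|exact: cK].
have [t|t|t|m mE] := @lift_unique R (F \o p) (G \o p).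
- by apply: (cK F) => u; have [] := FG _ (Tp u).
- by apply: (cK G) => u; have [] := FG _ (Tp u).
- by have [] := FG _ (Tp t).
have p0 : p 0 = z0 by rewrite /p clamp_id ?lexx ?ler01 // scale0r addr0.
have p1 : p 1 = z.
  by rewrite /p clamp_id ?lexx ?ler01 // scale1r addrC subrK.
have mn : m = n by apply: (@deck_inj R (G z0)); rewrite -nE -p0; have := mE 0.
by have := mE 1; rewrite /= p1 mn.
Qed.

Lemma germ_lift_unique (f g F G : plane -> plane) :
  germ_lift f F -> germ_lift g G -> near_end (fun z => f (polar z) = g (polar z)) ->
  exists n, germ_eq F (deck n \o G).
Proof.
move=> FT GT fg; have [T H] := near_end_and (near_end_and FT GT) fg.
have [|n nE] := @half_plane_lift_unique T F G.
  by move=> z /H[[[cF FE] [cG GE]] E]; split; rewrite ?FE ?GE.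
by exists n, T.
Qed.

Lemma germ_eq_sym F G : germ_eq F G -> germ_eq G F.
Proof. exact: near_endW. Qed.

Lemma germ_eq_trans F G H : germ_eq F G -> germ_eq G H -> germ_eq F H.
Proof.
by move=> FG GH; apply: near_endW (near_end_and FG GH) => z [-> ->].
Qed.

Lemma germ_eq_compl H F G : germ_eq F G -> germ_eq (H \o F) (H \o G).
Proof. by apply: near_endW => z /= ->. Qed.

Lemma germ_eq_compr f H F G : germ_lift f H ->
  germ_eq F G -> germ_eq (F \o H) (G \o H).
Proof. exact: germ_lift_end. Qed.

Lemma germ_lift_comp (f : plane -> plane) g F G :
  germ_lift f F -> germ_lift g G -> germ_lift (f \o g) (F \o G).
Proof.
move=> lf lg; apply: near_endW (near_end_and lg (germ_lift_end lg lf)).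
move=> z [[cG GE] [cF FE]]; split; last by rewrite /= FE GE.
exact: continuous_comp.
Qed.

Lemma germ_lift_deckr (f : plane -> plane) n F :
  germ_lift f F -> germ_lift f (F \o deck n).
Proof.
move=> [T FT]; exists T => z Tz.
have [cF FE] := FT (deck n z) Tz; split; last by rewrite /= FE polar_deck.
by apply: continuous_comp => //; apply: cvg_deck; exact: cvg_id.
Qed.

(* The circle of large radius has the same winding number around f 0 as
   around 0, and f preserves winding numbers. *)
Lemma germ_lift_deckC f F n : germ_lift f F ->
  germ_eq (F \o deck n) (deck n \o F).
Proof.
move=> lF; have [|m mE] := germ_lift_unique (germ_lift_deckr n lF) lF.
  by exists 0.
suff mn : m = n by rewrite mn in mE.
have [T H] := near_end_and (near_end_and lF mE)
  (homeo_proper f (dot (f 0) (f 0))).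
pose L (t : R) : plane := (T + 1, t * (n%:~R * (2 * pi))).
have TL t : T < (L t).1 by rewrite ltrDl.
have cL : continuous L.
  have c2 : continuous (fun t : R => t * (n%:~R * (2 * pi))).
    by move=> t; apply: cvgM; [exact: cvg_id|exact: cvg_cst].
  by move=> t; exact: (cvg_pair (cvg_cst _) (c2 t)).
have L1 : L 1 = deck n (L 0) by rewrite /L /deck /= mul0r add0r mul1r.
pose gamma t := polar (L t).
have w : winding gamma 0 n.
  by apply: (@path_winding R gamma L) => // t _; rewrite add0r.
have cfg : continuous (f \o gamma).
  move=> t; apply: continuous_comp; last exact: homeo_continuous.
  by apply: cvg_polar; exact: cL.
have w0 : winding (f \o gamma) 0 m.
  apply: (@path_winding R _ (F \o L)).
  - move=> t; apply: continuous_comp; first exact: cL.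
    by have [[[cF _] _] _] := H _ (TL t).
  - by move=> t _; have [[[_ FE] _] _] := H _ (TL t); rewrite add0r /= FE.
  - by have [[_ E] _] := H _ (TL 0); rewrite /= L1.
have := (homeo_orientation f gamma 0 n).1 w.
apply: winding_unique; apply: (@winding_dot R (f \o gamma)) w0.
- move=> t; apply: (@continuous_comp _ _ _ (clamp 1) (f \o gamma)).
    exact: continuous_clamp.
  exact: cfg.
- by rewrite /= /gamma L1 polar_deck.
move=> t _; rewrite subr0 /=.
have [_ /=] := H _ (TL t); rewrite -/(gamma t).
set v := f (gamma t); set u := f 0; rewrite /dot.
have -> : (v - u).1 = v.1 - u.1 by [].
have -> : (v - u).2 = v.2 - u.2 by [].
(* Twice the scalar product of [v] and [v - u] is the squared norm of [v], minus that of [u], plus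
   that of [v - u]; it is positive because [v] is longer than [u]. *)
have := sqr_ge0 (v.1 - u.1); have := sqr_ge0 (v.2 - u.2).
rewrite !expr2; nra.
Qed.

Lemma germ_eq_deck_inj m n F : germ_eq (deck m \o F) (deck n \o F) -> m = n.
Proof. by move/near_end_ex => [z /deck_inj]. Qed.

Lemma germ_lift_compC f g F G : germ_lift f F -> germ_lift g G -> forall n,
  germ_eq (F \o (deck n \o G)) (deck n \o (F \o G)).
Proof. by move=> lF lG n; exact: germ_eq_compr lG (germ_lift_deckC n lF). Qed.

(** The factor set of an arbitrary choice of lifts. The cocycle identity compares the two
    bracketings of [s f \o s g \o s h]; the second one moves a deck transformation across [s f]. *)
Lemma euler_cocycle_exists : exists c, @euler_cocycle R c.
Proof.
have [s sP] := choice germ_lift_exists.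
have H (p : homeo_plus R * homeo_plus R) : exists n,
    germ_eq (s p.1 \o s p.2) (deck n \o s (p.1 * p.2)%g).
  apply: germ_lift_unique (germ_lift_comp (sP _) (sP _)) (sP _) _.
  by exists 0.
have [c cP] := choice H.
have cc : c \in @is_cocycle (homeo_plus R) int.
  apply/asboolP/funext => -[[f g] h]; rewrite /coboundary2 /=.
  have E1 : germ_eq (s f \o s g \o s h)
      (deck (c (f, g) + c ((f * g)%g, h)) \o s (f * g * h)%g).
    apply: germ_eq_trans (germ_eq_compr (sP h) (cP (f, g))) _ => /=.
    apply: germ_eq_trans (germ_eq_compl (deck (c (f, g))) (cP ((f * g)%g, h))) _.
    by apply: near_endW (cP (f, g)) => z _; rewrite /= deck_deck.
  have E2 : germ_eq (s f \o s g \o s h)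
      (deck (c (g, h) + c (f, (g * h)%g)) \o s (f * g * h)%g).
    apply: germ_eq_trans (germ_eq_compl (s f) (cP (g, h))) _ => /=.
    apply: germ_eq_trans (germ_lift_compC (sP f) (sP _) _) _.
    apply: germ_eq_trans (germ_eq_compl (deck (c (g, h))) (cP (f, (g * h)%g))) _.
    by apply: near_endW (cP (f, g)) => z _; rewrite /= deck_deck mulgA.
  have := germ_eq_deck_inj (germ_eq_trans (germ_eq_sym E1) E2).
  move=> E; rewrite -[RHS]/(0 : int).
  move: (c (f, g)) (c (g, h)) (c (f, (g * h)%g)) (c ((f * g)%g, h)) E; lia.
by exists (Cocycle cc); exists s => // f g; exact: cP (f, g).
Qed.

(** Since an Euler cocycle exists, [xget] does not return its default value. *)
Lemma euler_classE : exists2 c, @euler_cocycle R c & euler_class R = cohom_class c.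
Proof.
have [c cP] := euler_cocycle_exists.
exact: (@xgetPex _ 0 [set x | exists2 c, @euler_cocycle R c & x = cohom_class c]
  (ex_intro _ (cohom_class c) (ex_intro2 _ _ c cP erefl))).
Qed.

End Germs.

(** * Group homomorphisms *)

Section MultiplicativeGroups.
Variables (G H : groupType) (f : {multiplicative G -> H}).
Local Open Scope group_scope.

Lemma multiplicative1 : f 1 = 1.
Proof. by apply: (mulgI (f 1)); rewrite -gmulfM !mulg1. Qed.

Lemma multiplicativeV x : f x^-1 = (f x)^-1.
Proof. by apply: (mulgI (f x)); rewrite -gmulfM !mulgV multiplicative1. Qed.

End MultiplicativeGroups.

(** * Homomorphisms out of a presented group *)

Section PresentedMorphism.
Variables (X : choiceType) (rels : set (seq (X * bool))) (H : groupType).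
Variable phi : X -> H.
Local Open Scope group_scope.

Definition letter_val (l : X * bool) : H :=
  if l.2 then (phi l.1)^-1 else phi l.1.

Definition word_val (w : seq (X * bool)) : H :=
  foldr (fun l x => letter_val l * x) 1 w.

Lemma word_val_cat u v : word_val (u ++ v) = word_val u * word_val v.
Proof. by elim: u => [|l u IH] /=; rewrite ?mul1g // IH mulgA. Qed.

Hypothesis phi_rels : forall r, rels r -> word_val r = 1.

Lemma word_val_eq u v : word_eq rels u v -> word_val u = word_val v.
Proof.
elim=> // [u1 u2 u3 _ -> _ -> //|u1 u2 v1 v2 _ E1 _ E2|x e].
  by rewrite !word_val_cat E1 E2.
by case: e; rewrite /= /letter_val /= mulg1 ?mulgV ?mulVg.
Qed.

(** The universal property of a presentation: evaluation of words sends the relators to 1, so its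
    value does not depend on the representative. *)
Lemma presented_group_morphism :
  exists rho : {multiplicative presented_group rels -> H},
    forall w, rho (pres_class rels w) = word_val w.
Proof.
pose f (x : presented_group rels) := word_val (repr x).
have fE w : f (pres_class rels w) = word_val w.
  by apply/word_val_eq/pres_classP; exact: pres_class_repr.
have fM : {morph f : x y / x * y >-> x * y}.
  move=> x y; rewrite -(pres_class_repr x) -(pres_class_repr y).
  by rewrite -pres_class_cat !fE word_val_cat.
pose rhoM := isMultiplicative.Build _ _ f fM.
pose rho : {multiplicative presented_group rels -> H} := HB.pack f rhoM.
by exists rho.
Qed.

End PresentedMorphism.

(** * The Euler number of an action of the genus 2 surface group *)

Section EulerNumber.
Variable R : realType.
Local Notation plane := (R * R)%type.
Local Open Scope group_scope.

Local Notation i0 := (ord0 : 'I_2).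
Local Notation i1 := (fintype.lift ord0 ord0 : 'I_2).

Lemma surface_relator2 : surface_relator 2 =
  [:: (inl i0, false); (inr i0, false); (inl i0, true); (inr i0, true);
      (inl i1, false); (inr i1, false); (inl i1, true); (inr i1, true)].
Proof. by rewrite /surface_relator !(enum_ordSl, enum_ord0). Qed.

Lemma surface_relator2_val (G : groupType) (phi : surface_gen 2 -> G) :
  word_val phi (surface_relator 2) =
  phi (inl i0) * phi (inr i0) * (phi (inl i0))^-1 * (phi (inr i0))^-1 *
  (phi (inl i1) * phi (inr i1) * (phi (inl i1))^-1 * (phi (inr i1))^-1).
Proof. by rewrite surface_relator2 /= /letter_val /= mulg1 !mulgA. Qed.

(** One term for each letter of the relator. [k] is the prefix formed by the first commutator, and
    the relation shortens the prefixes after the last two letters. *)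
Lemma kronecker_surface2 (G : groupType) (A : zmodType) (c : cocycle G A)
    (rho : {multiplicative surface_group 2 -> G}) a0 b0 a1 b1 :
  a0 = rho (surface_elt (inl i0)) -> b0 = rho (surface_elt (inr i0)) ->
  a1 = rho (surface_elt (inl i1)) ->
  b1 = rho (surface_elt (inr i1)) ->
  let k := a0 * b0 * a0^-1 * b0^-1 in
  zlift (cocycle_comp rho (idfun : {additive A -> A}) c)
     (fan_chain 1 (surface_relator 2)) =
  (c (1%g, a0) + c (a0, b0) - c ((k * b0)%g, a0) - c (k, b0) +
  (c (k, a1) + c ((k * a1)%g, b1) - c (b1, a1) - c (1%g, b1)))%R.
Proof.
move=> a0E b0E a1E b1E k.
rewrite surface_relator2.
have fanP p x w : fan_chain p ((x, false) :: w) =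
  (<< (p, surface_elt x) >> + fan_chain (p * surface_elt x)%g w)%R by [].
have fanN p x w : fan_chain p ((x, true) :: w) =
  (fan_chain (p * (surface_elt x)^-1)%g w -
   << ((p * (surface_elt x)^-1)%g, surface_elt x) >>)%R by [].
have fan0 p : fan_chain p [::] = 0%R :> {freeg (surface_group 2 * surface_group 2)}.
  by [].
rewrite !(fanP, fanN, fan0).
set x0 := surface_elt (inl i0) in a0E *.
set y0 := surface_elt (inr i0) in b0E *.
set x1 := surface_elt (inl _) in a1E *.
set y1 := surface_elt (inr _) in b1E *.
have rel : x0 * y0 * x0^-1 * y0^-1 * x1 * y1 * x1^-1 * y1^-1 = 1.
  pose r := [set surface_relator 2].
  have wE w : pres_class r w = foldr (fun l x => pres_class r [:: l] * x) 1 w.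
    elim: w => [//|l w IH]; rewrite -cat1s pres_class_cat [pres_class r w]IH.
    by [].
  have /pres_classP : word_eq r (surface_relator 2) [::] by exact: word_eq_rel.
  rewrite -[RHS]/(1 : surface_group 2) => <-.
  rewrite wE [in RHS]surface_relator2 /= !pres_class_letter mulg1.
  by rewrite !mulgA.
rewrite !mul1g rel.
(* The prefix of seven letters lacks only the final inverse of [y1]. *)
have -> : x0 * y0 * x0^-1 * y0^-1 * x1 * y1 * x1^-1 = y1.
  by rewrite -[LHS](mulgVK y1) rel mul1g.
pose zl := zlift (cocycle_comp rho (idfun : {additive A -> A}) c).
have zD u v : zl (u + v)%R = (zl u + zl v)%R by exact: raddfD.
have zN u : zl (- u)%R = (- zl u)%R by exact: raddfN.
have z0 : zl 0%R = 0%R by exact: raddf0.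
have zU u : zl << u >> = c (rho u.1, rho u.2) by exact: zliftU.
rewrite -/zl !(zD, zN, z0, zU) /=.
rewrite multiplicative1 !(gmulfM, multiplicativeV) -a0E -b0E -a1E -b1E.
rewrite mulgVK -/k add0r !addrA.
by rewrite [LHS](ACl (1*2*8*7*3*4*6*5)).
Qed.

(** The lifts [s p \o s f \o s g] and [s q \o s g \o s f] are deck transformations of the same
    [s (p * f * g)]. They also equal [s g \o s f] shifted by [e + m] and by [k], so the indices can
    be compared. *)
Lemma euler_block (c : cocycle (homeo_plus R) int)
    (s : homeo_plus R -> plane -> plane) (p q f g : homeo_plus R)
    (e k m : int) :
  (forall f : homeo_plus R, germ_lift f (s f)) ->
  (forall f g, germ_eq (s f \o s g) (deck (c (f, g)) \o s (f * g))) ->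
  q * g * f = p * f * g ->
  germ_eq (s p) (deck e) -> germ_eq (s q) (deck k) ->
  germ_eq (s f \o s g) (deck m \o (s g \o s f)) ->
  (c (p, f) + c ((p * f)%g, g) - c ((q * g)%g, f) - c (q, g) = e + m - k)%R.
Proof.
move=> sP cP qgf sp sq sm.
have triple x y z : germ_eq (s x \o (s y \o s z))
    (deck (c (x, y) + c ((x * y)%g, z))%R \o s (x * y * z)).
  apply: germ_eq_trans (germ_eq_compr (sP z) (cP x y)) _.
  apply: germ_eq_trans (germ_eq_compl (deck (c (x, y))) (cP (x * y) z)) _.
  by apply: near_endW (cP x y) => w _; rewrite /= deck_deck.
have lfg : germ_lift (f * g) (s f \o s g) by exact: germ_lift_comp (sP f) (sP g).
have lgf : germ_lift (g * f) (s g \o s f) by exact: germ_lift_comp (sP g) (sP f).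
have E1 : germ_eq (deck (c (p, f) + c ((p * f)%g, g))%R \o s (p * f * g))
    (deck (e + m)%R \o (s g \o s f)).
  apply: germ_eq_trans (germ_eq_sym (triple p f g)) _.
  apply: germ_eq_trans (germ_eq_compr lfg sp) _.
  apply: germ_eq_trans (germ_eq_compl (deck e) sm) _.
  by apply: near_endW sp => w _; rewrite /= deck_deck.
have E2 : germ_eq (deck (c (q, g) + c ((q * g)%g, f))%R \o s (p * f * g))
    (deck k \o (s g \o s f)).
  rewrite -qgf; apply: germ_eq_trans (germ_eq_sym (triple q g f)) _.
  exact: germ_eq_compr lgf sq.
have : (e + m - (c (p, f) + c ((p * f)%g, g)) = k - (c (q, g) + c ((q * g)%g, f)))%R.
  apply: (@germ_eq_deck_inj R _ _ (s g \o s f)).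
  apply: near_endW (near_end_and E1 E2) => w /= [e1 e2].
  rewrite [(e + m - _)%R]addrC [(k - _)%R]addrC -(deck_deck _ (e + m)%R).
  by rewrite -(deck_deck _ k) -e1 -e2 !deck_deck !addNr.
move: (c (p, f)) (c ((p * f)%g, g)) (c ((q * g)%g, f)) (c (q, g)); lia.
Qed.

(** Other lifts differ by deck transformations, which are central among lifts and cancel in the
    commutator. *)
Lemma commutator_lift_deck (f g : homeo_plus R) F G F' G' m :
  germ_lift f F -> germ_lift g G -> germ_lift f F' -> germ_lift g G' ->
  germ_eq (F \o G) (deck m \o (G \o F)) ->
  germ_eq (F' \o G') (deck m \o (G' \o F')).
Proof.
move=> lF lG lF' lG' FG.
have [|a aE] := germ_lift_unique lF' lF; first by exists 0%R.
have [|b bE] := germ_lift_unique lG' lG; first by exists 0%R.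
have E1 : germ_eq (F' \o G') (deck (a + b)%R \o (F \o G)).
  apply: germ_eq_trans (germ_eq_compr lG' aE) _.
  apply: germ_eq_trans (germ_eq_compl (deck a \o F) bE) _.
  apply: near_endW (germ_lift_compC lF lG b) => z /= ->.
  by rewrite deck_deck.
have E2 : germ_eq (G' \o F') (deck (b + a)%R \o (G \o F)).
  apply: germ_eq_trans (germ_eq_compr lF' bE) _.
  apply: germ_eq_trans (germ_eq_compl (deck b \o G) aE) _.
  apply: near_endW (germ_lift_compC lG lF a) => z /= ->.
  by rewrite deck_deck.
apply: near_endW (near_end_and FG (near_end_and E1 E2)) => z /= [e [-> ->]].
by rewrite e !deck_deck; congr deck; lia.
Qed.

(** The relator is cut at [k], which is trivial near infinity. [euler_block] applies to the two
    halves, with [p], [q] equal to [1], [k] and then [k], [1]; the contributions [e + m0 - d] and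
    [d + m1 - e] add up to [m0 + m1]. *)
Lemma euler_number_surface2 (rho : {multiplicative surface_group 2 -> diffeo_plus R})
    (a0 b0 a1 b1 : homeo_plus R) A0 B0 A1 B1 m0 m1 :
  a0 = rho (surface_elt (inl i0)) -> b0 = rho (surface_elt (inr i0)) ->
  a1 = rho (surface_elt (inl i1)) ->
  b1 = rho (surface_elt (inr i1)) ->
  (a0 * b0 * a0^-1 * b0^-1 * (a1 * b1 * a1^-1 * b1^-1) = 1) ->
  near_end (fun z => (a0 * b0 * a0^-1 * b0^-1) (polar z) = polar z) ->
  germ_lift a0 A0 -> germ_lift b0 B0 -> germ_lift a1 A1 -> germ_lift b1 B1 ->
  germ_eq (A0 \o B0) (deck m0 \o (B0 \o A0)) ->
  germ_eq (A1 \o B1) (deck m1 \o (B1 \o A1)) ->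
  kronecker (cohomology2_map rho (idfun : {additive int -> int})
    (euler_class_diffeo R)) (fundamental_class 2) = (m0 + m1)%R.
Proof.
move=> a0E b0E a1E b1E rel kE lA0 lB0 lA1 lB1 E0 E1.
set k := a0 * b0 * a0^-1 * b0^-1 in kE *.
have [c [s sP cP] ecE] := euler_classE R.
have -> : euler_class_diffeo R = cohom_class (cocycle_comp
    (val : {multiplicative diffeo_plus R -> homeo_plus R}) (idfun : {additive int -> int}) c).
  by rewrite /euler_class_diffeo ecE cohomology2_mapE.
rewrite cohomology2_mapE kroneckerE.
pose rhoM : {multiplicative surface_group 2 -> homeo_plus R} :=
  (val : {multiplicative diffeo_plus R -> homeo_plus R}) \o rho.
rewrite -[LHS]/(zlift (cocycle_comp rhoM (idfun : {additive int -> int}) c)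
  (fan_chain 1 (surface_relator 2))).
rewrite (kronecker_surface2 c (rho := rhoM) a0E b0E a1E b1E) -/k.
have lid : germ_lift (1 : homeo_plus R) id.
  by exists 0%R => z _; split=> //; exact: cvg_id.
have [|e eE] := germ_lift_unique (sP 1) lid; first by exists 0%R.
have [|d dE] := germ_lift_unique (sP k) lid; first exact: kE.
have M0 := commutator_lift_deck lA0 lB0 (sP a0) (sP b0) E0.
have M1 := commutator_lift_deck lA1 lB1 (sP a1) (sP b1) E1.
have c0 : k * b0 * a0 = 1 * a0 * b0 by rewrite /k !mulgVK mul1g.
have c1 : 1 * b1 * a1 = k * a1 * b1.
  have : k * (a1 * b1 * a1^-1 * b1^-1) * b1 * a1 = 1 * b1 * a1 by rewrite rel.
  by rewrite !mulgA !mulgVK => ->.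
have H0 := euler_block sP cP c0 eE dE M0.
have H1 := euler_block sP cP c1 dE eE M1.
rewrite mul1g in H0; rewrite mul1g in H1; rewrite H0 H1; lia.
Qed.

End EulerNumber.

(** * Smooth functions, and a flat function *)

Section SmoothFunctions.
Variable R : realType.
Local Notation plane := (R * R)%type.

Lemma near_eq_differentiable (V W : normedModType R) (f g : V -> W) (x : V) :
  (\forall y \near x, f y = g y) -> differentiable g x -> differentiable f x.
Proof.
move=> fg dg; have [cg gE] := (diff_locallyP _ _).1 dg.
have fE : f \o shift x = cst (f x) + 'd g x +o_ (0 : V) id.
  apply/eqaddoP => e e0; move/eqaddoP/(_ e e0): gE.
  have sx : h + x @[h --> (0 : V)] --> x.
    by rewrite -[X in _ --> X]add0r; apply: cvgD; [exact: cvg_id|exact: cvg_cst].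
  have fgx : \forall h \near (0 : V), f (h + x) = g (h + x) by exact: sx fg.
  by apply: filter_app; apply: filterS fgx => h /=; rewrite /cst !fctE /= => ->;
    rewrite (nbhs_singleton fg).
have dE := diff_unique cg fE.
by apply/diff_locallyP; split; rewrite dE.
Qed.

(** Smoothness can be checked locally, which serves for maps given by different formulas in
    different regions. *)
Lemma Ck_local (W : normedModType R) k (f : plane -> W) :
  (forall x : plane, exists2 g, Ck k g & \forall y \near x, f y = g y) -> Ck k f.
Proof.
elim: k f => [|k IH] f fP.
  move=> x; have [g cg fg] := fP x.
  rewrite /continuous_at (nbhs_singleton fg); apply: cvg_trans (cg x).
  by apply: near_eq_cvg; apply: filterS fg => y ->.
split=> [x|v].
  by have [g [dg _] fg] := fP x; exact: near_eq_differentiable fg (dg x).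
apply: IH => x; have [g [_ Dg] fg] := fP x; exists (fun y => 'D_v g y); first exact: Dg.
by apply: filterS (near_join fg) => y; exact: near_eq_derive.
Qed.

Lemma differentiable_comp_real (h : R -> R) (dh : R) (p : plane -> R) (z : plane) :
  is_derive (p z) 1 h dh -> differentiable p z ->
  differentiable (h \o p) z /\ forall v, 'D_v (h \o p) z = dh * 'D_v p z.
Proof.
move=> [/derivable1_diffP dhp <-] dp; split; first exact: differentiable_comp.
move=> v; rewrite deriveE; last exact: differentiable_comp.
rewrite diff_comp // !deriveE //= -[X in 'd h _ X = _]mulr1.
by rewrite [LHS]linearZ mulrC.
Qed.

Lemma Ck0_comp_real (h h' : R -> R) (p : plane -> R) :
  (forall z, is_derive (p z) 1 h (h' (p z))) -> Ck 0 p -> Ck 0 (h \o p).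
Proof.
move=> dh cp z; apply: continuous_comp; first exact: cp.
have [/derivable1_diffP + _] := dh z; exact: differentiable_continuous.
Qed.

(** The derivative of [h] is required only at values of [p], so that the inverse and the logarithm
    are covered. *)
Lemma CkS_comp_real k (h h' : R -> R) (p : plane -> R) :
  (forall z, is_derive (p z) 1 h (h' (p z))) ->
  Ck k (h' \o p) -> Ck k.+1 p -> Ck k.+1 (h \o p).
Proof.
move=> dh Ch' [dp Dp]; have H z := differentiable_comp_real (dh z) (dp z).
split=> [z|v]; first by have [] := H z.
apply: (@Ck_ext _ _ _ (fun z => (h' \o p) z * 'D_v p z));
  last exact: (CkM Ch' (Dp v)).
by move=> z; have [_ ->] := H z.
Qed.

Lemma CkN k (p : plane -> R) : Ck k p -> Ck k (fun z => - p z).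
Proof.
move=> Cp; apply: (@Ck_ext _ _ _ (fun z => -1 * p z)).
  by move=> z; rewrite mulN1r.
exact: CkM (Ck_cst _ _) Cp.
Qed.

Lemma Ck_cos_sin k (p : plane -> R) : Ck k p ->
  Ck k (fun z => cos (p z)) /\ Ck k (fun z => sin (p z)).
Proof.
elim: k p => [|k IH] p Cp.
  by split; [exact: (Ck0_comp_real (h' := fun x => - sin x))
            |exact: (Ck0_comp_real (h' := cos))].
have [Cc Cs] := IH p (CkW Cp); split.
  by apply: (CkS_comp_real (h' := fun x => - sin x)) => //; exact: CkN.
exact: (CkS_comp_real (h' := cos)).
Qed.

Lemma Ck_inv k (p : plane -> R) : (forall z, p z != 0) -> Ck k p ->
  Ck k (fun z => (p z)^-1).
Proof.
move=> p0.
have dh z : is_derive (p z) 1 (@GRing.inv R) (- ((p z)^-1 * (p z)^-1)).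
  apply: (is_derive_eq (is_deriveV (f := id) (p0 z) _)).
  by rewrite -[LHS]/(_ * _) mulr1 expr2 invfM.
elim: k => [|k IH] Cp; first exact: (Ck0_comp_real (h' := fun a => - (a^-1 * a^-1)) dh).
have Ci := IH (CkW Cp).
exact: (CkS_comp_real (h' := fun a => - (a^-1 * a^-1)) dh (CkN (CkM Ci Ci)) Cp).
Qed.

Lemma Ck_ln k (p : plane -> R) : (forall z, 0 < p z) -> Ck k p ->
  Ck k (fun z => ln (p z)).
Proof.
move=> p0; have dh z : is_derive (p z) 1 (@ln R) (p z)^-1 by exact: is_derive1_ln.
case: k => [|k] Cp; first exact: (Ck0_comp_real (h' := @GRing.inv R) dh).
apply: (CkS_comp_real (h' := @GRing.inv R) dh _ Cp).
by apply: Ck_inv (CkW Cp) => z; exact: lt0r_neq0.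
Qed.

(** For [n = 0] the classical function exp (-1/x), extended by 0. The powers of 1/x make the family
    stable under differentiation up to linear combinations. *)
Definition flat (n : nat) (x : R) : R :=
  if 0 < x then expR (- x^-1) * x^-1 ^+ n else 0.

(** With [y] the inverse of [x], the term of degree [n + 2] of the exponential series is at most
    [expR y]. The quadratic bound forces the derivative at 0 to vanish. *)
Lemma flat_le n x : `|flat n x| <= (n.+2)`!%:R * x ^+ 2.
Proof.
rewrite /flat; case: ltP => x0; last by rewrite normr0 mulr_ge0 ?sqr_ge0.
set y := x^-1; have y0 : 0 < y by rewrite invr_gt0.
have yN : y != 0 by exact: lt0r_neq0.
rewrite ger0_norm; last by rewrite mulr_ge0 ?expR_ge0 // exprn_ge0 // ltW.
have := expR_ge1Dxn n.+1 (ltW y0).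
have -> : x ^+ 2 = y ^- 2 by rewrite /y exprVn invrK.
set c : R := _%:R; have c0 : 0 < c by rewrite ltr0n fact_gt0.
move=> H; have : y ^+ n.+2 / c <= expR y.
  by apply: le_trans H; rewrite lerDr.
rewrite ler_pdivrMr // => H1; rewrite expRN ler_pdivrMl ?expR_gt0 // mulrA.
by rewrite ler_pdivlMr ?exprn_gt0 // -exprD addn2.
Qed.

Lemma is_derive_flat n (x : R) :
  is_derive x 1 (flat n) (- (n%:R * flat n.+1 x) + flat n.+2 x).
Proof.
have [x0|x0|x0] := ltgtP 0 x; last rewrite -{x}x0.
- apply: (@near_eq_is_derive _ _ _ ((expR \o (- (fun y : R => y^-1))) * ((fun y => y^-1) ^+ n))).
    near=> y; have y0 : 0 < y by near: y; exact: lt_nbhsr.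
    by rewrite /flat y0 !fctE.
  have xN : x != 0 by exact: lt0r_neq0.
  have dV : is_derive x 1 (fun y : R => y^-1) (- x ^- 2 *: 1).
    exact: (is_deriveV (f := id)).
  apply: is_derive_eq; rewrite /flat x0. rewrite !fctE -!exprVn.
  rewrite -![_ *: _]/(_ * _); set y := x^-1; set e := expR _.
  by case: n => [|n] /=; rewrite ?exprS; ring.
- apply: (@near_eq_is_derive _ _ _ (cst 0)).
    near=> y; have y0 : y < 0 by near: y; exact: lt_nbhsl.
    by rewrite /flat ltNge (ltW y0).
  apply: is_derive_eq; by rewrite /flat ltNge (ltW x0) /= mulr0 oppr0 addr0.
(* At 0, [flat_le] bounds the difference quotient by a constant times the absolute value of [h]. *)
have H : (fun h => h^-1 *: ((flat n \o shift 0) (h *: 1) - flat n 0)) @ 0^' --> (0 : R).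
  have c0 : 0 < (n.+2)`!%:R :> R by rewrite ltr0n fact_gt0.
  apply/cvgrPdist_le => e e0; near=> h.
  have hN : h != 0 by near: h; exact: nbhs_dnbhs_neq.
  rewrite sub0r normrN /= addr0 [X in _ - X](_ : _ = 0); last by rewrite /flat ltxx.
  rewrite subr0 normrM normfV [h *: 1]mulr1.
  rewrite ler_pdivrMl ?normr_gt0 //; apply: le_trans (flat_le _ _) _.
  rewrite -real_normK ?num_real // expr2 mulrCA ler_wpM2l // mulrC -ler_pdivlMr //.
  by near: h; apply: dnbhs0_le; exact: divr_gt0.
apply: DeriveDef; first by apply/cvg_ex; exists 0.
rewrite /flat ltxx mulr0 oppr0 addr0; exact: cvg_lim.
Unshelve. all: by end_near. Qed.

Lemma Ck_flat k n (p : plane -> R) : Ck k p -> Ck k (fun z => flat n (p z)).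
Proof.
elim: k n p => [|k IH] n p Cp; pose dflat x := - (n%:R * flat n.+1 x) + flat n.+2 x.
  exact: (@Ck0_comp_real _ dflat _ (fun z => is_derive_flat n (p z))).
have Cf m : Ck k (fun z => flat m (p z)) := IH m p (CkW Cp).
apply: (@CkS_comp_real k _ dflat _ (fun z => is_derive_flat n (p z)) _ Cp).
exact: CkD (CkN (CkM (Ck_cst _ _) (Cf n.+1))) (Cf n.+2).
Qed.

End SmoothFunctions.

(** * Diffeomorphisms: twists about centres and affine maps *)

Section Diffeomorphisms.
Variable R : realType.
Local Notation plane := (R * R)%type.

Definition rot (t : R) (v : plane) : plane :=
  (v.1 * cos t - v.2 * sin t, v.1 * sin t + v.2 * cos t).

Lemma rot0 v : rot 0 v = v.
Proof.
by rewrite /rot cos0 sin0 !mulr1 !mulr0 subr0 add0r -surjective_pairing.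
Qed.

Lemma rotD s t v : rot s (rot t v) = rot (s + t) v.
Proof. by rewrite /rot /= cosD sinD; congr pair; ring. Qed.

Lemma rotZ t k (v : plane) : rot t (k *: v) = k *: rot t v.
Proof.
rewrite -[LHS]/(k * v.1 * cos t - k * v.2 * sin t,
               k * v.1 * sin t + k * v.2 * cos t).
rewrite -[RHS]/(k * (v.1 * cos t - v.2 * sin t), k * (v.1 * sin t + v.2 * cos t)).
by congr pair; ring.
Qed.

Lemma rotB2pi t (n : int) v : rot (t - n%:~R * (2 * pi)) v = rot t v.
Proof. by rewrite -mulNr -mulrNz /rot cosD2piz sinD2piz. Qed.

Lemma dot_rot t v : dot (rot t v) (rot t v) = dot v v.
Proof.
rewrite /dot /rot /= -[RHS]mulr1 -(cos2Dsin2 t); ring.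
Qed.

Lemma rot_polar t (z : plane) : rot t (polar z) = polar (z.1, z.2 + t).
Proof. by rewrite /rot /polar /= cosD sinD; congr pair; ring. Qed.

Lemma Ck_id k : Ck k (id : plane -> plane).
Proof. exact: smooth_id. Qed.

Lemma Ck_sub k (c : plane) : Ck k (fun z => z - c).
Proof. exact: (CkD (Ck_id k) (Ck_cst k (- c))). Qed.

Lemma Ck_dot k (f g : plane -> plane) : Ck k f -> Ck k g ->
  Ck k (fun z => dot (f z) (g z)).
Proof.
move=> Cf Cg.
exact: (CkD (CkM (Ck_fst Cf) (Ck_fst Cg)) (CkM (Ck_snd Cf) (Ck_snd Cg))).
Qed.

Lemma Ck_rot k (t : plane -> R) (f : plane -> plane) :
  Ck k t -> Ck k f -> Ck k (fun z => rot (t z) (f z)).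
Proof.
move=> Ct Cf; have [Cc Cs] := Ck_cos_sin Ct.
have [C1 C2] := (Ck_fst Cf, Ck_snd Cf).
exact: (Ck_pair (CkD (CkM C1 Cc) (CkN (CkM C2 Cs))) (CkD (CkM C1 Cs) (CkM C2 Cc))).
Qed.

Lemma cvg_rot (T : Type) (F : set_system T) (FF : Filter F)
    (t : T -> R) (f : T -> plane) (t0 : R) (v : plane) :
  t x @[x --> F] --> t0 -> f x @[x --> F] --> v ->
  rot (t x) (f x) @[x --> F] --> rot t0 v.
Proof.
move=> ct cf; have f1 : (f x).1 @[x --> F] --> v.1 by exact: cvg_fst_of.
have f2 : (f x).2 @[x --> F] --> v.2 by exact: cvg_snd_of.
have cc : cos (t x) @[x --> F] --> cos t0.
  by apply: (continuous_cvg _ _ ct); exact: continuous_cos.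
have cs : sin (t x) @[x --> F] --> sin t0.
  by apply: (continuous_cvg _ _ ct); exact: continuous_sin.
have r1 : (f x).1 * cos (t x) - (f x).2 * sin (t x) @[x --> F] -->
    v.1 * cos t0 - v.2 * sin t0.
  by apply: cvgB; exact: cvgM.
have r2 : (f x).1 * sin (t x) + (f x).2 * cos (t x) @[x --> F] -->
    v.1 * sin t0 + v.2 * cos t0.
  by apply: cvgD; exact: cvgM.
exact: (cvg_pair r1 r2).
Qed.

Section Twist.
Variables (a : R -> R) (c : plane -> plane).

(* The parameter s is the time of an isotopy from the identity.  The centre c z
   may jump, but only where the angle vanishes. *)
Definition twist (s : R) (z : plane) : plane :=
  c z + rot (s * a (dot (z - c z) (z - c z))) (z - c z).

Hypothesis smooth_a : smooth (fun z : plane => a (dot z z)).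
Hypothesis c_local : forall z0, \forall z \near z0, c z = c z0 \/
  a (dot (z - c z) (z - c z)) = 0 /\ a (dot (z - c z0) (z - c z0)) = 0.
Hypothesis c_rot : forall t z, a (dot (z - c z) (z - c z)) != 0 ->
  c (c z + rot t (z - c z)) = c z.

Lemma twist0 z : twist 0 z = z.
Proof. by rewrite /twist mul0r rot0 addrC subrK. Qed.

Lemma twist_id s z : a (dot (z - c z) (z - c z)) = 0 -> twist s z = z.
Proof. by rewrite /twist => ->; rewrite mulr0 rot0 addrC subrK. Qed.

(** A point rotated about its centre keeps the same centre, by [c_rot], and the same distance to it;
    hence the angles add up. *)
Lemma twistD s t z : twist s (twist t z) = twist (s + t) z.
Proof.
have [a0|aN] := eqVneq (a (dot (z - c z) (z - c z))) 0.
  by rewrite !twist_id.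
rewrite /twist c_rot // [c z + _ - c z]addrAC subrr add0r dot_rot rotD.
by rewrite mulrDl.
Qed.

Lemma twist_local z0 : \forall z \near z0, forall s,
  twist s z = c z0 + rot (s * a (dot (z - c z0) (z - c z0))) (z - c z0).
Proof.
apply: filterS (c_local z0) => z + s; case=> [cz|[a0 a1]]; first by rewrite /twist cz.
by rewrite twist_id // a1 mulr0 rot0 addrC subrK.
Qed.

Lemma smooth_twist s : smooth (twist s).
Proof.
move=> k; apply: Ck_local => z0.
exists (fun z => c z0 + rot (s * a (dot (z - c z0) (z - c z0))) (z - c z0)); last first.
  by apply: filterS (twist_local z0) => z ->.
apply: (CkD (Ck_cst _ _)); apply: Ck_rot; last exact: Ck_sub.
apply: (CkM (Ck_cst _ _)).
exact: (Ck_comp_scalar (smooth_a k) (Ck_sub k (c z0))).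
Qed.

Lemma continuous_twist : continuous (fun p : R * plane => twist p.1 p.2).
Proof.
move=> [s0 z0].
pose g (p : R * plane) :=
  c z0 + rot (p.1 * a (dot (p.2 - c z0) (p.2 - c z0))) (p.2 - c z0).
have gE : \forall p \near (s0, z0), g p = twist p.1 p.2.
  have cs : snd p @[p --> (s0, z0)] --> z0 by exact: cvg_snd.
  have := cs _ (twist_local z0); rewrite nbhs_simpl.
  by apply: (@filterS _ (nbhs (s0, z0))) => p /= ->.
have c2 : p.2 - c z0 @[p --> (s0, z0)] --> z0 - c z0.
  by apply: cvgB; [exact: cvg_snd|exact: cvg_cst].
have ca : a (dot (p.2 - c z0) (p.2 - c z0)) @[p --> (s0, z0)] -->
    a (dot (z0 - c z0) (z0 - c z0)).
  exact: (continuous_cvg _ (smooth_a 0%N (z0 - c z0)) c2).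
have cg : g p @[p --> (s0, z0)] --> g (s0, z0).
  apply: cvgD; first exact: cvg_cst.
  by apply: cvg_rot => //; apply: cvgM; [exact: cvg_fst|exact: ca].
rewrite /continuous_at /= -[twist s0 z0](nbhs_singleton gE).
by apply: cvg_trans cg; apply: near_eq_cvg; exact: gE.
Qed.

(** The inverse is the twist at time -1. Both maps are ends of isotopies from the identity, hence
    preserve winding numbers. *)
Lemma twist_diffeo : exists f : diffeo_plus R, forall z, f z = twist 1 z.
Proof.
have K s : cancel (twist s) (twist (- s)).
  by move=> z; rewrite twistD addNr twist0.
have K1 : cancel (twist (- 1)) (twist 1) by move=> z; rewrite twistD subrr twist0.
have cs s : continuous (twist s) := smooth_twist s 0%N.
have w : forall gamma x n, winding gamma x n ->
    winding (twist 1 \o gamma) (twist 1 x) n.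
  apply: (isotopy_winding continuous_twist _ twist0) => s.
  exact: can_inj (K s).
have wN : forall gamma x n, winding gamma x n ->
    winding (twist (- 1) \o gamma) (twist (- 1) x) n.
  apply: (@isotopy_winding R (fun s => twist (- s))).
  - move=> p; apply: (@continuous_comp _ _ _ (fun p : R * plane => (- p.1, p.2))
      (fun p : R * plane => twist p.1 p.2)); last exact: continuous_twist.
    have c1 : - q.1 @[q --> p] --> - p.1 by apply: cvgN; exact: cvg_fst.
    exact: (cvg_pair c1 cvg_snd).
  - by move=> s; exact: can_inj (K (- s)).
  - by move=> z; rewrite oppr0 twist0.
pose h := HomeoPlus (K 1) K1 (cs 1) (cs (- 1)) (orientation_of_winding (K 1) w wN).
have hd : h \in @is_diffeo R by apply/asboolP; split; exact: smooth_twist.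
by exists (DiffeoPlus hd).
Qed.

End Twist.

(** Scaling by [k] translates the lift by [ln k] in the radial coordinate, which leaves the index
    unchanged. *)
Lemma affine_winding (k : R) (b : plane) gamma x n : 0 < k ->
  winding gamma x n -> winding (fun t => k *: gamma t + b) (k *: x + b) n.
Proof.
move=> k0 /winding_path[F [cF FE F1]].
apply: (@path_winding R _ (fun t => ((F t).1 + ln k, (F t).2))).
- move=> t; have c1 : (F u).1 @[u --> t] --> (F t).1 by exact: cvg_fst_of (cF t).
  have c2 : (F u).2 @[u --> t] --> (F t).2 by exact: cvg_snd_of (cF t).
  exact: (cvg_pair (cvgD c1 (cvg_cst _)) c2).
- move=> t t01; have := FE t; rewrite clamp_id // => ->.
  rewrite scalerDr addrAC; congr (_ + _).
  rewrite /polar /= expRD lnK ?posrE // -[LHS]/(k * _, k * _) /=.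
  by congr pair; ring.
- by rewrite F1.
Qed.

Lemma affine_diffeo (k : R) (b : plane) : 0 < k ->
  exists f : diffeo_plus R, forall z, f z = k *: z + b.
Proof.
move=> k0; have kN := lt0r_neq0 k0; have kV : 0 < k^-1 by rewrite invr_gt0.
pose aff k b (z : plane) : plane := k *: z + b.
have saff l d : smooth (aff l d).
  move=> m; apply: (@Ck_ext _ _ _ (fun z : plane => (l * z.1 + d.1, l * z.2 + d.2))).
    by move=> z.
  by apply: Ck_pair; apply: CkD; [|exact: Ck_cst| |exact: Ck_cst];
    apply: (CkM (Ck_cst _ _)); [exact: (Ck_fst (Ck_id m))|exact: (Ck_snd (Ck_id m))].
have K : cancel (aff k b) (aff k^-1 (- (k^-1 *: b))).
  by move=> z; rewrite /aff scalerDr scalerA mulVf // scale1r addrK.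
have K' : cancel (aff k^-1 (- (k^-1 *: b))) (aff k b).
  by move=> z; rewrite /aff scalerDr scalerN !scalerA mulfV // !scale1r subrK.
pose h := HomeoPlus K K' (saff _ _ 0%N) (saff _ _ 0%N)
  (orientation_of_winding K (fun gamma x n => affine_winding b k0)
    (fun gamma x n => affine_winding _ kV)).
have hd : h \in @is_diffeo R by apply/asboolP; split; exact: saff.
by exists (DiffeoPlus hd).
Qed.

End Diffeomorphisms.

(** * The four generators and their commutators *)

Section Generators.
Variables (R : realType) (i : int).
Local Notation plane := (R * R)%type.

Definition slope : R := i%:~R * (2 * pi) / ln 4.

(** The flat term vanishes for [u >= 1], so the angle is exactly logarithmic there; for [0 <= u < 1]
    it keeps the argument of the logarithm positive, hence the angle smooth at the origin. *)
Definition spiral_angle (u : R) : R := slope * ln (u + flat 0 (1 - u)).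

(** The multiple of 2 pi does not affect the rotation; it makes the angle itself vanish for
    [u >= 4]. *)
Definition bump_angle (u : R) : R :=
  spiral_angle u - spiral_angle (u / 4) - i%:~R * (2 * pi).

(** The centre [(6 n, 0)] of the vertical strip of width 6 containing [z]. As [truncn] is 0 on
    negative numbers, all points to the left belong to the centre 0. *)
Definition center (z : plane) : plane :=
  (6 * (Num.truncn ((z.1 + 3) / 6))%:R, 0).

Lemma ln4_neq0 : ln 4 != 0 :> R.
Proof. by rewrite gt_eqF // ln_gt0 // ltr1n. Qed.

Lemma spiral_angleE u : 1 <= u -> spiral_angle u = slope * ln u.
Proof. by move=> u1; rewrite /spiral_angle /flat subr_gt0 ltNge u1 addr0. Qed.

Lemma bump_angle_eq0 u : 4 <= u -> bump_angle u = 0.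
Proof.
move=> u4; rewrite /bump_angle !spiral_angleE; [|lra|lra].
have u0 : 0 < u by lra.
rewrite ln_div ?posrE // /slope; field; exact: ln4_neq0.
Qed.

Lemma Ck_spiral_angle k (p : plane -> R) : (forall z, 0 <= p z) -> Ck k p ->
  Ck k (fun z => spiral_angle (p z)).
Proof.
move=> p0 Cp; apply: (CkM (Ck_cst _ _)); apply: Ck_ln.
  move=> z; have := p0 z; rewrite le_eqVlt => /orP[/eqP <-|pz].
    by rewrite add0r subr0 /flat ltr01 invr1 mulr_gt0 ?expR_gt0 // exprn_gt0.
  apply: ltr_pwDl => //; rewrite /flat; case: ifP => // ?.
  by rewrite mulr_ge0 ?expR_ge0 // exprn_ge0 // invr_ge0 ltW.
apply: (CkD Cp); apply: Ck_flat; exact: (CkD (Ck_cst _ _) (CkN Cp)).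
Qed.

Lemma smooth_spiral_angle : smooth (fun z : plane => spiral_angle (dot z z)).
Proof.
move=> k; have Cd := Ck_dot (@Ck_id R k) (@Ck_id R k).
exact: (Ck_spiral_angle (@dotvv_ge0 R) Cd).
Qed.

Lemma smooth_bump_angle : smooth (fun z : plane => bump_angle (dot z z)).
Proof.
move=> k; have Cd := Ck_dot (@Ck_id R k) (@Ck_id R k).
have d4 (z : plane) : 0 <= dot z z / 4 by rewrite mulr_ge0 ?dotvv_ge0 // invr_ge0.
have C4 := Ck_spiral_angle d4 (CkM Cd (Ck_cst k (4^-1 : R))).
exact: (CkD (CkD (smooth_spiral_angle k) (CkN C4)) (Ck_cst _ _)).
Qed.

Lemma bump_angle_lt (v : plane) : bump_angle (dot v v) != 0 -> -2 < v.1 < 2.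
Proof.
move=> bN; have : dot v v < 4.
  by rewrite ltNge; apply: contra bN => d4; rewrite bump_angle_eq0.
rewrite /dot => d; have := sqr_ge0 v.2; rewrite expr2 => v2.
by apply/andP; split; nra.
Qed.

Lemma center_eq (n : nat) (z : plane) : -3 <= z.1 - 6 * n%:R < 3 ->
  center z = (6 * n%:R, 0).
Proof.
move=> /andP[z1 z2]; rewrite /center; congr (6 * _%:R, _).
apply: truncn_def; rewrite -natr1; apply/andP; split; lra.
Qed.

(** Inside an open strip the centre is locally constant. Otherwise [z0] is at horizontal distance at
    least 3 from every centre, and within 1 of it no bump, of radius 2, is met. *)
Lemma center_local (z0 : plane) : \forall z \near z0, center z = center z0 \/
  bump_angle (dot (z - center z) (z - center z)) = 0 /\
  bump_angle (dot (z - center z0) (z - center z0)) = 0.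
Proof.
have near_fst (e : R) : 0 < e -> \forall z \near z0, `|z0.1 - z.1| < e.
  move=> e0; have c1 : z.1 @[z --> z0] --> z0.1 by exact: cvg_fst.
  exact: (@cvgr_dist_lt _ _ _ _ _ _ _ c1 e e0).
have [[n nz0]|far] := pselect (exists n : nat, -3 < z0.1 - 6 * n%:R < 3).
  have e0 : 0 < Num.min (3 - (z0.1 - 6 * n%:R)) (3 + (z0.1 - 6 * n%:R)).
    by rewrite lt_min; lra.
  apply: filterS (near_fst _ e0) => z; rewrite lt_min => /andP[].
  rewrite !ltr_distl => h1 h2; left.
  by rewrite !(@center_eq n) //; lra.
have b0 (z : plane) (m : nat) : `|z0.1 - z.1| < 1 ->
    bump_angle (dot (z - (6 * m%:R, 0)) (z - (6 * m%:R, 0))) = 0.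
  rewrite ltr_distl => /andP[h1 h2]; apply: contrapT => /eqP /bump_angle_lt.
  rewrite -[(z - _).1]/(z.1 - 6 * m%:R) => /andP[h3 h4].
  by apply: far; exists m; lra.
by apply: filterS (near_fst 1 ltr01) => z z1; right; split; exact: b0.
Qed.

Lemma center_rot t (z : plane) :
  bump_angle (dot (z - center z) (z - center z)) != 0 ->
  center (center z + rot t (z - center z)) = center z.
Proof.
move=> bN; rewrite {3}/center; apply: center_eq.
have : -2 < (rot t (z - center z)).1 < 2 by apply: bump_angle_lt; rewrite dot_rot.
rewrite -[(_ + _).1]/((center z).1 + (rot t (z - center z)).1) {3}/center /=.
lra.
Qed.

(** In the notation of the overview, [spiral] is B, [chain] is F and [bump] is the commutator
    [B, A]. *)
Let spiral := twist spiral_angle (fun=> 0 : plane) 1.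
Let chain := twist bump_angle center 1.
Let bump (z : plane) := rot (bump_angle (dot z z)) z.

Lemma spiralE z : spiral z = rot (spiral_angle (dot z z)) z.
Proof. by rewrite /spiral /twist !subr0 mul1r add0r. Qed.

(** This is the identity [B, A] A B = B A. At squared norm 4u the bump angle adds th(4u) - th(u) - 2
    pi i to the angle th(u) already applied. *)
Lemma bump_spiral z : bump (2 *: spiral z) = spiral (2 *: z).
Proof.
rewrite !spiralE /bump.
have E v : dot (2 *: v) (2 *: v) = dot v v * 4.
  rewrite /dot -[(2 *: v).1]/(2 * v.1) -[(2 *: v).2]/(2 * v.2); ring.
rewrite !E dot_rot rotZ rotD rotZ /bump_angle mulfK ?pnatr_eq0 //.
set s := spiral_angle _; set t := spiral_angle _.
by rewrite addrAC subrK rotB2pi.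
Qed.

Lemma bump_id z : 4 <= dot z z -> bump z = z.
Proof. by move=> z4; rewrite /bump bump_angle_eq0 // rot0. Qed.

Lemma chain_id (z : plane) : z.1 < -2 -> chain z = z.
Proof.
move=> z2; apply: twist_id; apply: contrapT => /eqP /bump_angle_lt.
rewrite -[(z - _).1]/(z.1 - 6 * (Num.truncn ((z.1 + 3) / 6))%:R).
have : 0 <= (Num.truncn ((z.1 + 3) / 6))%:R :> R by [].
move: (_%:R) => n n0 /andP[]; lra.
Qed.

Lemma chain1_ge (z : plane) : -3 <= z.1 -> -3 <= (chain z).1.
Proof.
move=> z3; have [b0|/[dup] bN /bump_angle_lt z2] :=
  eqVneq (bump_angle (dot (z - center z) (z - center z))) 0.
  by rewrite /chain twist_id.
have : -2 < (rot (1 * bump_angle (dot (z - center z) (z - center z)))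
    (z - center z)).1 < 2 by apply: bump_angle_lt; rewrite dot_rot.
rewrite /chain /twist; move: (rot _ _) => v v2.
rewrite -[(_ + v).1]/(6 * (Num.truncn ((z.1 + 3) / 6))%:R + v.1).
have : 0 <= (Num.truncn ((z.1 + 3) / 6))%:R :> R by [].
by move: (_%:R) => n n0; lra.
Qed.

(** This is the identity [B, A] T F = F T, proved separately on the two sides of the line
    [z.1 = -3]. *)
Lemma bump_chain z : bump (chain z + (6, 0)) = chain (z + (6, 0)).
Proof.
have [z3|z3] := leP (-3) z.1.
  have cz : center (z + (6, 0)) = center z + (6, 0).
    have x0 : 0 <= (z.1 + 3) / 6 by rewrite mulr_ge0 ?invr_ge0 //; lra.
    have /andP[n1 n2] := truncn_itv x0; move: n1 n2.
    rewrite [in RHS]/center; set n := Num.truncn _ => n1 n2.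
    rewrite (@center_eq n.+1).
      rewrite -[RHS]/(6 * n%:R + 6, 0 + 0) addr0 -natr1; congr pair; ring.
    rewrite -[(z + _).1]/(z.1 + 6) -natr1; move: n1 n2; rewrite -natr1 => n1 n2.
    lra.
  (* The centres are shifted along with the point, so F and T commute here; the image then has first
     coordinate at least 3, beyond the bump. *)
  have -> : chain (z + (6, 0)) = chain z + (6, 0).
    by rewrite /chain /twist cz opprD addrACA subrr addr0 addrAC.
  rewrite bump_id // /dot; have := chain1_ge z3.
  move: (chain z) => v v3; rewrite -[(v + _).1]/(v.1 + 6).
  by have := sqr_ge0 (v + (6, 0)).2; rewrite expr2; nra.
(* On this side F fixes [z], while the translate of [z] has centre 0, so that F acts on it as the
   bump. *)
have c1 : center (z + (6, 0)) = 0.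
  rewrite /center -[(z + _).1]/(z.1 + 6).
  suff -> : Num.truncn ((z.1 + 6 + 3) / 6) = 0%N by rewrite mulr0.
  by apply/eqP; rewrite -leqn0 truncn_le_nat; lra.
rewrite chain_id; last lra.
by rewrite /chain /twist c1 !subr0 mul1r add0r.
Qed.

Definition dilation_lift (z : plane) : plane := (z.1 + ln 2, z.2).
Definition spiral_lift (z : plane) : plane := (z.1, z.2 + slope * (z.1 *+ 2)).

Lemma dilation_liftP (f : plane -> plane) : (forall z, f z = 2 *: z + 0) ->
  germ_lift f dilation_lift.
Proof.
move=> fE; exists 0 => z _; split.
  exact: (cvg_pair (cvgD (@cvg_fst _ _ _ _ _) (cvg_cst _)) cvg_snd).
rewrite fE addr0 /polar /dilation_lift /= expRD lnK ?posrE //.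
rewrite -[RHS]/(2 * (expR z.1 * cos z.2), 2 * (expR z.1 * sin z.2)).
by congr pair; ring.
Qed.

Lemma spiral_liftP (f : plane -> plane) : (forall z, f z = spiral z) ->
  germ_lift f spiral_lift.
Proof.
move=> fE; exists 0 => z z0; split.
  have c1 : w.1 @[w --> z] --> z.1 by exact: cvg_fst.
  have c2 : w.2 @[w --> z] --> z.2 by exact: cvg_snd.
  have c3 : w.2 + slope * (w.1 *+ 2) @[w --> z] --> z.2 + slope * (z.1 *+ 2).
    apply: cvgD => //; apply: cvgM; first exact: cvg_cst.
    by rewrite mulr2n; apply: cvgD.
  exact: (cvg_pair c1 c3).
rewrite fE spiralE dot_polar spiral_angleE ?expRK ?rot_polar //.
by rewrite -expR0 ler_expR mulrn_wge0 // ltW.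
Qed.

Lemma spiral_dilation_deck :
  germ_eq (spiral_lift \o dilation_lift) (deck i \o (dilation_lift \o spiral_lift)).
Proof.
exists 0 => z _; rewrite /spiral_lift /dilation_lift /deck /=; congr pair.
have -> : i%:~R * (2 * pi) = slope * (ln 2 *+ 2).
  have -> : ln 2 *+ 2 = ln 4 :> R.
    by rewrite -lnXn // -natrX.
  by rewrite /slope divfK // ln4_neq0.
by rewrite mulrnDl; ring.
Qed.

(* On the ray of argument pi, the translation and the chain of bumps can be
   lifted without turning. *)
Lemma translation_chain_deck (f g : homeo_plus R) (F G : plane -> plane) :
  (forall z, f z = 1 *: z + (6, 0)) -> (forall z, g z = chain z) ->
  germ_lift f F -> germ_lift g G -> germ_eq (F \o G) (deck 0 \o (G \o F)).
Proof.
move=> fE gE lF lG.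
have fg0 : near_end (fun z => f (g (polar z)) = g (f (polar z))).
  have := homeo_proper (f * g)%g 4; apply: near_endW => z z4.
  have <- : bump (f (g (polar z))) = f (g (polar z)) by exact: bump_id (ltW z4).
  by rewrite !fE !gE !scale1r bump_chain.
have [m mE] := germ_lift_unique (germ_lift_comp lF lG) (germ_lift_comp lG lF) fg0.
suff m0 : m = 0 by rewrite m0 in mE.
have polar_pi (s : R) : polar (s, pi) = (- expR s, 0).
  by rewrite /polar /= cospi sinpi mulrN1 mulr0.
have [S H] := near_end_and lF lG.
pose S0 := Num.max S 6 + 1.
have [SS0 S7] : S < S0 /\ 7 <= S0.
  by rewrite /S0; case: (leP S 6) => ?; split; lra.
have expS0 (s : R) : S0 <= s -> 6 < expR s.
  by move=> s0; have := expR_ge1Dx s; lra.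
pose u (r : R) := Num.max S0 r.
have uS0 r : S0 <= u r by rewrite /u le_max lexx.
have cu : continuous u.
  by move=> r; apply: (@continuous_max _ _ (cst S0) id); [exact: cvg_cst|exact: cvg_id].
(* [q] runs along the negative real axis, and [q'] lifts its translate by [(6, 0)] at the same
   angle; [expS0] keeps this translate on the negative axis. *)
pose q r : plane := (u r, pi).
pose q' r : plane := (ln (expR (u r) - 6), pi).
have cq : continuous q by move=> r; exact: (cvg_pair (cu r) (cvg_cst _)).
have cq' : continuous q'.
  move=> r; have c1 : ln (expR (u t) - 6) @[t --> r] --> ln (expR (u r) - 6).
    have cd : expR (u t) - 6 @[t --> r] --> expR (u r) - 6.
      apply: cvgB; last exact: cvg_cst.
      by apply: (continuous_cvg _ _ (cu r)); exact: continuous_expR.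
    apply: (continuous_cvg _ _ cd); apply: continuous_ln.
    by rewrite subr_gt0 expS0.
  exact: (cvg_pair c1 (cvg_cst _)).
have qS r : S < (q r).1 by exact: lt_le_trans SS0 (uS0 r).
(* The chain is the identity on the ray, so [G] acts there as a deck transformation [b]; likewise
   [F] carries [q] to [q'] up to a deck transformation [a]. *)
have [r|r||b bE] := @lift_unique R (G \o q) q.
- by apply: continuous_comp; [exact: cq|have [_ []] := H _ (qS r)].
- exact: cq.
- move=> r; have [_ [_ /= ->]] := H _ (qS r).
  rewrite gE chain_id // polar_pi /=; have := expS0 _ (uS0 r); lra.
have [r|r||a aE] := @lift_unique R (F \o q) q'.
- by apply: continuous_comp; [exact: cq|have [[]] := H _ (qS r)].
- exact: cq'.
- move=> r; have [[_ /= ->] _] := H _ (qS r).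
  rewrite fE !polar_pi scale1r lnK ?posrE ?subr_gt0 ?expS0 //.
  rewrite -[LHS]/(- expR (u r) + 6, 0 + 0) addr0; congr pair; ring.
have [S2 H2] := near_end_and mE
  (near_end_and (germ_lift_deckC b lF) (germ_lift_deckC a lG)).
(* [r] is so large that the translated point [q' r] is again a point [q s] of the ray with [s >= U].
   Then both [F (G (q r))] and [G (F (q r))] equal [deck (a + b) (q s)]. *)
pose U := Num.max S0 (S2 + 1); pose r := expR U + 6.
have [US0 US2] : S0 <= U /\ S2 < U.
  by rewrite /U; case: (leP S0 (S2 + 1)) => ?; split; lra.
have rU : U <= r by rewrite /r; have := expR_ge1Dx U; lra.
pose s := ln (expR r - 6).
have sU : U <= s.
  have rr : expR U <= expR r - 6 by have := expR_ge1Dx r; rewrite /r; lra.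
  rewrite -[U]expRK ler_ln // posrE ?expR_gt0 //.
  exact: lt_le_trans (expR_gt0 U) rr.
have qr : q r = (r, pi) by rewrite /q /u max_r // (le_trans US0).
have q'r : q' r = (s, pi) by rewrite /q' /u max_r // (le_trans US0).
have qs : q s = (s, pi) by rewrite /q /u max_r // (le_trans US0).
have [mr [fr _]] : F (G (q r)) = deck m (G (F (q r))) /\
    (F (deck b (q r)) = deck b (F (q r)) /\ G (deck a (q r)) = deck a (G (q r))).
  by apply: H2; rewrite qr; exact: lt_le_trans US2 rU.
have [_ [_ gs]] : F (G (q s)) = deck m (G (F (q s))) /\
    (F (deck b (q s)) = deck b (F (q s)) /\ G (deck a (q s)) = deck a (G (q s))).
  by apply: H2; rewrite qs; exact: lt_le_trans US2 sU.
have := bE r; have := bE s; have := aE r => /= ar bs br.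
move: mr; rewrite br fr ar q'r -qs gs bs !deck_deck => /deck_inj; lia.
Qed.

End Generators.

(** * Actions with prescribed Euler number, and unboundedness *)

Section EulerNumbers.
Variable R : realType.
Local Notation plane := (R * R)%type.

Lemma surface_action_exists (i : int) :
  exists rho : {multiplicative surface_group 2 -> diffeo_plus R},
    kronecker (cohomology2_map rho (idfun : {additive int -> int})
      (euler_class_diffeo R)) (fundamental_class 2) = i.
Proof.
have [B BE] : exists f : diffeo_plus R, forall z,
    f z = twist (spiral_angle i) (fun=> 0 : plane) 1 z.
  apply: twist_diffeo => //; first exact: smooth_spiral_angle.
  by move=> z0; apply: (@filterE _ (nbhs z0)) => z; left.
have [F FE] := twist_diffeo (smooth_bump_angle R i) (center_local i) (@center_rot R i).
have [A AE] := affine_diffeo (0 : plane) (ltr0n R 2).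
have [T TE] := affine_diffeo ((6, 0) : plane) (@ltr01 R).
pose phi (x : surface_gen 2) : diffeo_plus R :=
  match x with
  | inl j => if j == ord0 then B else T
  | inr j => if j == ord0 then A else F
  end.
pose v : {multiplicative diffeo_plus R -> homeo_plus R} := val.
have KE w : (v B * v A * (v B)^-1 * (v A)^-1)%g w = rot (bump_angle i (dot w w)) w.
  (* With [w] written as A B u, the commutator sends it to B A u, and [bump_spiral] identifies this
     with the bump at [w]. *)
  pose u := homeo_inv (v B) (homeo_inv (v A) w).
  have Bu : B u = homeo_inv (v A) w := homeo_invK (v B) _.
  have wE : 2 *: B u = w.
    by rewrite -[RHS](homeo_invK (v A)) -Bu -[RHS]/(A (B u)) AE addr0.
  by rewrite -[LHS]/(B (A u)) BE AE addr0 -bump_spiral -BE wE.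
have rel : (v B * v A * (v B)^-1 * (v A)^-1 *
            (v T * v F * (v T)^-1 * (v F)^-1) = 1)%g.
  apply: homeo_eq => w.
  (* With [w] written as F T u, the second commutator sends it to T F u, which the bump sends back
     to [w] by [bump_chain]. *)
  pose u := homeo_inv (v T) (homeo_inv (v F) w).
  rewrite -[LHS]/((v B * v A * (v B)^-1 * (v A)^-1)%g (T (F u))) KE.
  rewrite TE FE scale1r bump_chain -FE -[u in LHS]scale1r -TE.
  by rewrite (homeo_invK (v T)) (homeo_invK (v F)).
have phi_rel r : [set surface_relator 2] r -> word_val phi r = 1%g.
  move=> ->; rewrite surface_relator2_val /=.
  apply: val_inj; rewrite -[val]/(v : _ -> _) !(gmulfM, multiplicativeV).
  by rewrite rel multiplicative1.
have [rho rhoE] := presented_group_morphism phi_rel.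
have rho_gen x : rho (surface_elt x) = phi x.
  by rewrite rhoE /= /letter_val /= mulg1.
exists rho.
have [T' lT] := germ_lift_exists (v T); have [F' lF] := germ_lift_exists (v F).
rewrite (@euler_number_surface2 R rho (v B) (v A) (v T) (v F)
  (spiral_lift i) (@dilation_lift R) T' F' i 0) ?addr0 ?rho_gen //.
(* For [z.1 > 2] the squared norm is at least [1 + 2 * z.1 > 4], outside the support of the bump. *)
- exists 2 => z z2; rewrite KE bump_angle_eq0 ?rot0 // dot_polar.
  by apply: le_trans (expR_ge1Dx _); rewrite mulr2n; lra.
- exact: spiral_liftP.
- exact: dilation_liftP.
- exact: spiral_dilation_deck.
- exact: translation_chain_deck TE FE lT lF.
Qed.

Lemma zlift_intr (G : groupType) (c : G * G -> int) z :
  zlift (fun p => (c p)%:~R : R) z = (zlift c z)%:~R.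
Proof.
apply/esym; have := @zlift_uniq _ _ (fun p => (c p)%:~R : R)
  ((intr : {additive int -> R}) \o zlift c : {additive _ -> R}).
by apply=> p /=; rewrite zliftU.
Qed.

(** Cohomologous cocycles agree on the fundamental cycle, so the Euler number is a signed sum of
    eight values of the bounded real cocycle, whatever [rho] is. *)
Lemma bounded_class_euler_number (G : groupType) (x : cohomology2 G int) :
  bounded_class R x -> exists M : R,
  forall rho : {multiplicative surface_group 2 -> G},
    `|(kronecker (cohomology2_map rho (idfun : {additive int -> int}) x)
        (fundamental_class 2))%:~R| <= M.
Proof.
rewrite -(cohom_class_repr x); move: (repr x) => c0.
case=> c; rewrite cohomology2_mapE => cE [M cM]; exists (M *+ 8) => rho.
have E : zlift (cocycle_comp rho (idfun : {additive R -> R}) c)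
      (fan_chain 1%g (surface_relator 2)) =
    (kronecker (cohomology2_map rho (idfun : {additive int -> int})
       (cohom_class c0)) (fundamental_class 2))%:~R.
  have := congr1 (fun y => kronecker (cohomology2_map rho
    (idfun : {additive R -> R}) y) (fundamental_class 2)) cE.
  rewrite !cohomology2_mapE !kroneckerE /= => ->.
  exact: zlift_intr.
rewrite -E (kronecker_surface2 c erefl erefl erefl erefl).
set k := (_ * _ * _ * _)%g.
have n8 (a1 a2 a3 a4 a5 a6 a7 a8 : R) : `|a1| <= M -> `|a2| <= M -> `|a3| <= M ->
   `|a4| <= M -> `|a5| <= M -> `|a6| <= M -> `|a7| <= M -> `|a8| <= M ->
   `|a1 + a2 - a3 - a4 + (a5 + a6 - a7 - a8)| <= M *+ 8.
  by rewrite !ler_norml -mulr_natl; lra.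
by apply: n8; exact: cM.
Qed.

End EulerNumbers.

Theorem theoremC (R : realType) :
  (forall i : int,
     exists rho : {multiplicative surface_group 2 -> diffeo_plus R},
       kronecker
         (cohomology2_map rho (idfun : {additive int -> int})
            (euler_class_diffeo R))
         (fundamental_class 2) = i) /\
  ~ bounded_class R (euler_class_diffeo R).
Proof.
split; first exact: surface_action_exists.
move=> /bounded_class_euler_number[M MP].
(* The prescribed Euler number is an integer greater than the bound [M]. *)
have [rho rhoE] := surface_action_exists R (Num.truncn M).+1.
have := MP rho; rewrite rhoE => /(le_trans (ler_norm _)).
by rewrite leNgt truncnS_gt.
Qed.
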